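(* Let $\tau:E\to M$ be an affine bundle modelled on the vector bundle $\boldsymbol{\tau}:V\to M$, let $\tilde\tau:\tilde E\to M$ be its bidual vector bundle, and let $i:E\to\tilde E$, $\boldsymbol{i}:V\to\tilde E$ be the canonical maps. (1) Suppose a (vector) Lie algebroid structure $([\,,\,],\tilde\rho)$ is given on $\tilde E$ such that the bracket of any two sections in the image of $i$ lies in the image of $\boldsymbol{i}$. Then it defines a Lie algebroid structure on the affine bundle $E$, where the bracket on $\mathrm{Sec}(V)$, the action $D$ of $\mathrm{Sec}(E)$ on $\mathrm{Sec}(V)$ and the anchor $\rho:E\to TM$ are determined by $$\boldsymbol{i}([\boldsymbol{\eta}_1,\boldsymbol{\eta}_2])=[\boldsymbol{i}(\boldsymbol{\eta}_1),\boldsymbol{i}(\boldsymbol{\eta}_2)],\qquad \boldsymbol{i}(D_\sigma\boldsymbol{\eta})=[i(\sigma),\boldsymbol{i}(\boldsymbol{\eta})],\qquad \rho(\sigma)=\tilde\rho(i(\sigma)),$$ for $\sigma\in\mathrm{Sec}(E)$ and $\boldsymbol{\eta},\boldsymbol{\eta}_1,\boldsymbol{\eta}_2\in\mathrm{Sec}(V)$. (2) Conversely, a Lie algebroid structure on the affine bundle $E$ (with bracket $[\,,\,]$ on $\mathrm{Sec}(V)$, action $D$, and anchor $\rho$ with linear part $\boldsymbol{\rho}:V\to TM$) extends to a Lie algebroid structure on the vector bundle $\tilde E$ such that the bracket of sections in the image of $i$ is in the image of $\boldsymbol{i}$. If one fixes a section $\sigma$ of $E$ and writes sections $\zeta$ of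 $\tilde E$ (locally) in the form $\zeta=f\,i(\sigma)+\boldsymbol{i}(\boldsymbol{\eta})$, with $f$ a function on $M$ and $\boldsymbol{\eta}$ a section of $V$, then the anchor and the bracket are given by $$\tilde\rho(\zeta)=f\rho(\sigma)+\boldsymbol{\rho}(\boldsymbol{\eta}),$$ $$[\zeta_1,\zeta_2]=\bigl(\tilde\rho(\zeta_1)(f_2)-\tilde\rho(\zeta_2)(f_1)\bigr)\,i(\sigma)+\boldsymbol{i}\bigl([\boldsymbol{\eta}_1,\boldsymbol{\eta}_2]+f_1D_\sigma\boldsymbol{\eta}_2-f_2D_\sigma\boldsymbol{\eta}_1\bigr),$$ where $\zeta_k=f_k\,i(\sigma)+\boldsymbol{i}(\boldsymbol{\eta}_k)$, $k=1,2$.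
   Context: All bundles are smooth of finite rank. $\mathrm{Sec}(\cdot)$ denotes smooth sections; a bundle map over the identity and the induced map on sections are denoted by the same symbol. Bidual of an affine bundle: for $m\in M$, $E_m^\dagger=\mathrm{Aff}(E_m,\mathbb{R})$ is the vector space of affine functions $E_m\to\mathbb{R}$; these form the vector bundle $E^\dagger\to M$, and $\tilde E=(E^\dagger)^*$ is its dual bundle. For $\varphi\in E^\dagger_m$ let $\boldsymbol{\varphi}\in V_m^*$ be its linear part. The canonical immersion $i:E\to\tilde E$ is $i(a)(\varphi)=\varphi(a)$; its linear part is $\boldsymbol{i}:V\to\tilde E$, $\boldsymbol{i}(\boldsymbol{v})(\varphi)=\boldsymbol{\varphi}(\boldsymbol{v})$. Lie algebra structure on an affine space $A$ modelled on a real vector space $W$: a Lie algebra structure $[\,,\,]$ on $W$ together with a map $D:A\times W\to W$, $(a,\boldsymbol{v})\mapsto D_a\boldsymbol{v}$, such that each $D_a$ is $\mathbb{R}$-linear, $D_a[\boldsymbol{v},\boldsymbol{w}]=[D_a\boldsymbol{v},\boldsymbol{w}]+[\boldsymbol{v},D_a\boldsymbol{w}]$, and $D_{a+\boldsymbol{v}}\boldsymbol{w}=D_a\boldsymbol{w}+[\boldsymbol{v},\boldsymbol{w}]$. Lie algebroid structure on the affine bundle $E$: a Lie algebra structure on the (real) affine space $\mathrm{Sec}(E)$ (modelled on the real vector space $\mathrm{Sec}(V)$), together with an affine bundle map $\rho:E\to TM$ over the identity of $M$ (the anchor), such that $D_\sigma(f\boldsymbol{\zeta})=\rho(\sigma)(f)\,\boldsymbol{\zeta}+fD_\sigma\boldsymbol{\zeta}$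 for all $\sigma\in\mathrm{Sec}(E)$, $\boldsymbol{\zeta}\in\mathrm{Sec}(V)$, $f\in C^\infty(M)$. *)

(* Defs.v *)
From HB Require Import structures.
From mathcomp Require Import all_boot all_order all_algebra.
From mathcomp Require Import all_classical all_reals all_analysis.
Set Implicit Arguments.
Unset Strict Implicit.
Unset Printing Implicit Defensive.
Import Order.TTheory GRing.Theory Num.Theory numFieldNormedType.Exports.
Local Open Scope classical_set_scope.
Local Open Scope ring_scope.

Section calculus.
Context {R : realType}.

(* f is C^k on the open set U iff it is Frechet differentiable on U and all its
   directional derivatives are C^(k-1) on U. *)
Fixpoint is_Ck {V W : normedModType R} (k : nat) (U : set V) (f : V -> W)
    : Prop :=
  if k is k'.+1 then
    (forall x, U x -> differentiable f x) /\
    (forall v, is_Ck k' U (fun x => 'D_v f x))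
  else forall x, U x -> {for x, continuous f}.

Definition is_smooth {V W : normedModType R} (U : set V) (f : V -> W) : Prop :=
  forall k, is_Ck k U f.

Lemma near_eq_differentiable (V W : normedModType R) (f g : V -> W) x :
  (\forall y \near x, f y = g y) -> differentiable f x -> differentiable g x.
Proof.
move=> fg df.
have fg0 : \forall y \near (0 : V), f (y + x) = g (y + x).
  by move: fg; rewrite (near_shift 0) subr0.
have E : g \o shift x = cst (g x) + 'd f x +o_ (0 : V) id.
  apply/eqaddoP => e e0.
  have /eqaddoP /(_ e e0) := diff_locally df.
  apply: filterS2 fg0 => y Ey; rewrite !fctE /= -Ey.
  by rewrite -(nbhs_singleton fg).
have Ed : 'd g x = 'd f x :> (V -> W).
  by apply: diff_unique => //; exact: diff_continuous.
by apply/diff_locallyP; rewrite Ed; split => //; exact: diff_continuous.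
Qed.

Lemma Ck_ext (V W : normedModType R) k (U : set V) (f g : V -> W) :
  open U -> {in U, f =1 g} -> is_Ck k U f -> is_Ck k U g.
Proof.
move=> oU; elim: k f g => [|k IHk] f g fg.
  move=> fc x Ux.
  have nfg : \forall y \near x, f y = g y.
    by apply: filterS (open_nbhs_nbhs (conj oU Ux)) => y Uy; apply: fg; rewrite inE.
  have := fc x Ux; rewrite /prop_for /continuous_at (nbhs_singleton nfg).
  by apply: cvg_trans; apply: near_eq_cvg; apply: filterS nfg => y ->.
have nfg x : U x -> \forall y \near x, f y = g y.
  by move=> Ux; apply: filterS (open_nbhs_nbhs (conj oU Ux)) => y Uy; apply: fg; rewrite inE.
move=> [df Df]; split=> [x Ux|v].
  exact: near_eq_differentiable (nfg _ Ux) (df _ Ux).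
apply: IHk (Df v) => x; rewrite inE => Ux.
exact: near_eq_derive (nfg x Ux).
Qed.

Lemma CkW (V W : normedModType R) k (U : set V) (f : V -> W) :
  is_Ck k.+1 U f -> is_Ck k U f.
Proof.
elim: k f => [|k IHk] f [df Df].
  by move=> x Ux; apply: differentiable_continuous; exact: df.
by split=> // v; apply: IHk; exact: Df.
Qed.

Lemma Ck_bigcup (V W : normedModType R) k (U : set V) (f : V -> W) :
  (forall x, U x -> exists2 B, B x & is_Ck k B f) -> is_Ck k U f.
Proof.
elim: k f => [|k IHk] f H.
  by move=> x /H[B Bx]; exact.
split=> [x /H[B Bx [dO _]]|v]; first exact: dO.
by apply: IHk => x /H[B Bx [_ DO]]; exists B => //; exact: DO.
Qed.

Lemma CkS (V W : normedModType R) k (U O : set V) (f : V -> W) :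
  U `<=` O -> is_Ck k O f -> is_Ck k U f.
Proof. by move=> UO fO; apply: Ck_bigcup => x /UO Ox; exists O. Qed.

Lemma Ck_cst (V W : normedModType R) k (U : set V) (a : W) :
  is_Ck k U (fun=> a).
Proof.
elim: k a => [|k IHk] a; first by move=> x _; exact: cst_continuous.
split=> [x _|v]; first exact: differentiable_cst.
have -> : (fun x => 'D_v (fun=> a) x) = (fun=> 0 : W).
  by apply/funext => x; exact: derive_cst.
exact: IHk.
Qed.

Lemma CkD (V W : normedModType R) k (U : set V) (f g : V -> W) :
  open U -> is_Ck k U f -> is_Ck k U g -> is_Ck k U (fun x => f x + g x).
Proof.
move=> oU; elim: k f g => [|k IHk] f g.
  by move=> cf cg x Ux; apply: cvgD; [exact: cf|exact: cg].
move=> [df Df] [dg Dg]; split=> [x Ux|v].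
  by apply: differentiableD; [exact: df|exact: dg].
apply: (@Ck_ext _ _ _ _ (fun x => 'D_v f x + 'D_v g x)) => //; last first.
  by apply: IHk; [exact: Df|exact: Dg].
move=> x; rewrite inE => Ux; rewrite -deriveD //.
- by apply: diff_derivable; exact: df.
- by apply: diff_derivable; exact: dg.
Qed.

Lemma Ck_sum (V W : normedModType R) k (U : set V) I (r : seq I)
    (f : I -> V -> W) :
  open U -> (forall i, is_Ck k U (f i)) ->
  is_Ck k U (fun x => \sum_(i <- r) f i x).
Proof.
move=> oU Hf; elim: r => [|i r IHr].
  by under eq_fun do rewrite big_nil; exact: Ck_cst.
by under eq_fun do rewrite big_cons; exact: CkD.
Qed.

Lemma Ck_scale (V W : normedModType R) k (U : set V) (f : V -> R) (g : V -> W) :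
  open U -> is_Ck k U f -> is_Ck k U g -> is_Ck k U (fun x => f x *: g x).
Proof.
move=> oU.
have scale_bil : bilinear_for (GRing.Scale.Law.clone _ _ *:%R _)
    (GRing.Scale.Law.clone _ _ *:%R _) (fun (a : R) (w : W) => a *: w).
  split=> [w|a] b x y /=; first by rewrite scalerDl scalerA.
  by rewrite scalerDr !scalerA mulrC.
pose scM := bilinear_isBilinear.Build R R W W _ _ (fun a w => a *: w) scale_bil.
pose sc : {bilinear R -> W -> W} := HB.pack (fun (a : R) (w : W) => a *: w) scM.
have sc_cont : continuous (fun p : R * W => sc p.1 p.2).
  exact: scale_continuous.
have scE (h : V -> R) (l : V -> W) : (fun x => h x *: l x) =
    (fun p : R * W => sc p.1 p.2) \o (fun x => (h x, l x)) by [].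
elim: k f g => [|k IHk] f g.
  by move=> cf cg x Ux; apply: cvgZ; [exact: cf|exact: cg].
move=> [df Df] [dg Dg].
have dfg x : U x -> differentiable (fun x => f x *: g x) x.
  move=> Ux; rewrite scE; apply: differentiable_comp.
    by apply: differentiable_pair; [exact: df|exact: dg].
  exact: differentiable_bilin.
split=> // v.
have Cg : is_Ck k U g by apply: CkW.
have Cf : is_Ck k U f by apply: CkW.
apply: (@Ck_ext _ _ _ _ (fun x => f x *: 'D_v g x + 'D_v f x *: g x)) => //.
  move=> x; rewrite inE => Ux.
  have dfx := df x Ux; have dgx := dg x Ux.
  have dp := differentiable_pair dfx dgx.
  have ds := @differentiable_bilin _ _ _ _ sc (f x, g x) sc_cont.
  have := congr1 (@^~ ('d (fun y => (f y, g y)) x v))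
    (@diff_bilin _ _ _ _ sc (f x, g x) sc_cont).
  have := congr1 (@^~ v) (diff_pair dfx dgx).
  rewrite /= => ->; rewrite /= -(deriveE _ dfx) -(deriveE _ dgx) => <-.
  rewrite [RHS](deriveE _ (dfg x Ux)) scE.
  by rewrite (diff_comp dp ds) /= (congr1 (@^~ v) (diff_pair dfx dgx)) /= -(deriveE _ dfx) -(deriveE _ dgx).
by apply: CkD => //; apply: IHk => //; [exact: Dg|exact: Df].
Qed.

Lemma Ck_linear (V W : normedModType R) k (U : set V) (L : {linear V -> W}) :
  continuous L -> is_Ck k U L.
Proof.
move=> cL; case: k => [|k]; first by move=> x _; exact: cL.
split=> [x _|v]; first exact: linear_differentiable.
have -> : (fun x => 'D_v L x) = (fun=> L v).
  apply/funext => x; rewrite deriveE; last exact: linear_differentiable.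
  by rewrite diff_lin.
exact: Ck_cst.
Qed.

Lemma Ck_coord (V : normedModType R) p k (U : set V) (f : V -> 'rV[R]_p) j :
  open U -> is_Ck k U f -> is_Ck k U (fun x => f x 0 j).
Proof.
move=> oU; elim: k f => [|k IHk] f.
  move=> cf x Ux; apply: (@continuous_comp _ _ _ f (fun M : 'rV[R]_p => M 0 j)).
    exact: cf.
  exact: coord_continuous.
move=> [df Df]; split=> [x Ux|v].
  apply: (@differentiable_comp _ _ _ _ f (fun M : 'rV[R]_p => M 0 j)).
    exact: df.
  exact: differentiable_coord.
apply: Ck_ext (IHk _ (Df v)) => // x; rewrite inE => Ux.
by rewrite derive_mx ?mxE //; apply: diff_derivable; exact: df.
Qed.

Lemma Ck_rV (V : normedModType R) p k (U : set V) (f : V -> 'rV[R]_p) :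
  open U -> (forall j, is_Ck k U (fun x => f x 0 j)) -> is_Ck k U f.
Proof.
move=> oU fj; rewrite (_ : f = fun x => \sum_j f x 0 j *: delta_mx 0 j).
  by apply: Ck_sum => // j; apply: Ck_scale => //; exact: Ck_cst.
by apply/funext => x; rewrite {1}[f x]row_sum_delta.
Qed.

Lemma Ck_comp (V W : normedModType R) p k (U : set V) (O : set 'rV[R]_p)
    (f : V -> 'rV[R]_p) (g : 'rV[R]_p -> W) :
  open U -> open O -> (forall x, U x -> O (f x)) ->
  is_Ck k U f -> is_Ck k O g -> is_Ck k U (g \o f).
Proof.
move=> oU oO fUO; elim: k g => [|k IHk] g.
  move=> cf cg x Ux; apply: continuous_comp; first exact: cf.
  by apply: cg; exact: fUO.
move=> Cf [dg Dg]; have [df Df] := Cf.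
split=> [x Ux|v].
  by apply: differentiable_comp; [exact: df|exact: dg (fUO _ Ux)].
apply: (@Ck_ext _ _ _ _
    (fun x => \sum_i 'D_v f x 0 i *: 'D_(delta_mx 0 i) g (f x))) => //; last first.
  apply: Ck_sum => // i; apply: Ck_scale => //; first exact: (Ck_coord _ oU (Df v)).
  exact: (IHk (fun y => 'D_(delta_mx 0 i) g y) (CkW Cf) (Dg _)).
move=> x; rewrite inE => Ux.
have dfx := df x Ux; have dgx := dg _ (fUO x Ux).
rewrite [RHS]deriveE; last exact: differentiable_comp.
rewrite diff_comp //= -(deriveE _ dfx) [X in 'd g _ X]row_sum_delta linear_sum /=.
by apply: eq_bigr => i _; rewrite linearZ /= -deriveE.
Qed.

End calculus.

(* [atr a v] is a + v and [asub b a] is b - a.  Nonemptiness is not required: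
   the fibres of an affine bundle are nonempty because they are covered by
   trivializations, and spaces of sections because the base is a manifold. *)
Record affSpace (R : realType) (W : lmodType R) := AffSpace {
  apt :> Type ;
  atr : apt -> W -> apt ;
  asub : apt -> apt -> W ;
  atr0 : forall a, atr a 0 = a ;
  atrD : forall a v w, atr (atr a v) w = atr a (v + w) ;
  atrK : forall a v, asub (atr a v) a = v ;
  asubK : forall b a, atr a (asub b a) = b
}.

Section dual_space.
Context {R : realType} (W : lmodType R).

Record dual := Dual {
  dual_fun :> W -> R ;
  dual_scalar : scalar dual_fun
}.

Lemma dual_eq (f g : dual) : f =1 g -> f = g.
Proof.
case: f g => f sf [g sg] /= /funext fg; subst g.
by congr Dual; exact: Prop_irrelevance.
Qed.

Fact dual0_scalar : scalar (fun _ : W => 0 : R).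
Proof. by move=> a u v; rewrite mulr0 addr0. Qed.
Fact dualD_scalar (f g : dual) : scalar (fun w => f w + g w).
Proof. by move=> a u v; rewrite !dual_scalar mulrDr addrACA. Qed.
Fact dualZ_scalar (a : R) (f : dual) : scalar (fun w => a * f w).
Proof. by move=> b u v; rewrite dual_scalar mulrDr mulrCA. Qed.
Fact dualN_scalar (f : dual) : scalar (fun w => - f w).
Proof. by move=> a u v; rewrite dual_scalar opprD mulrN. Qed.

Definition dual0 := Dual dual0_scalar.
Definition dualD f g := Dual (dualD_scalar f g).
Definition dualN f := Dual (dualN_scalar f).
Definition dualZ a f := Dual (dualZ_scalar a f).

Fact dualDA : associative dualD.
Proof. by move=> f g h; apply: dual_eq => w; exact: addrA. Qed.
Fact dualDC : commutative dualD.
Proof. by move=> f g; apply: dual_eq => w; exact: addrC. Qed.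
Fact dual0D : left_id dual0 dualD.
Proof. by move=> f; apply: dual_eq => w; exact: add0r. Qed.
Fact dualND : left_inverse dual0 dualN dualD.
Proof. by move=> f; apply: dual_eq => w; exact: addNr. Qed.

HB.instance Definition _ := gen_eqMixin dual.
HB.instance Definition _ := gen_choiceMixin dual.
HB.instance Definition _ := GRing.isZmodule.Build dual
  dualDA dualDC dual0D dualND.

Fact dualZA a b f : dualZ a (dualZ b f) = dualZ (a * b) f.
Proof. by apply: dual_eq => w; exact: mulrA. Qed.
Fact dual1Z : left_id 1 dualZ.
Proof. by move=> f; apply: dual_eq => w; exact: mul1r. Qed.
Fact dualZDr : right_distributive dualZ +%R.
Proof. by move=> a f g; apply: dual_eq => w; exact: mulrDr. Qed.
Fact dualZDl f : {morph dualZ^~ f : a b / a + b}.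
Proof. by move=> a b; apply: dual_eq => w; exact: mulrDl. Qed.

HB.instance Definition _ := GRing.Zmodule_isLmodule.Build R dual
  dualZA dual1Z dualZDr dualZDl.
End dual_space.

Section affine_functions.
Context {R : realType} (W : lmodType R) (A : affSpace W).

(* Affine functions on A, bundled with their linear part [af_lin] (which is
   uniquely determined as soon as A is nonempty). *)
Record affFun := AffFun {
  af_fun :> A -> R ;
  af_lin : W -> R ;
  af_scalar : scalar af_lin ;
  af_tr : forall a v, af_fun (atr a v) = af_fun a + af_lin v
}.

Lemma affFun_eq (f g : affFun) : f =1 g -> af_lin f =1 af_lin g -> f = g.
Proof.
case: f g => f l sf tf [g k sg tg] /= /funext fg /funext lk; subst g k.
by congr AffFun; exact: Prop_irrelevance.
Qed.

Fact af0_scalar : scalar (fun _ : W => 0 : R).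
Proof. by move=> a u v; rewrite mulr0 addr0. Qed.
Fact afD_scalar (f g : affFun) : scalar (fun w => af_lin f w + af_lin g w).
Proof. by move=> a u v; rewrite !af_scalar mulrDr addrACA. Qed.
Fact afZ_scalar (a : R) (f : affFun) : scalar (fun w => a * af_lin f w).
Proof. by move=> b u v; rewrite af_scalar mulrDr mulrCA. Qed.
Fact afN_scalar (f : affFun) : scalar (fun w => - af_lin f w).
Proof. by move=> a u v; rewrite af_scalar opprD mulrN. Qed.

Fact af0_tr (a : A) (v : W) : 0 = 0 + 0 :> R.
Proof. by rewrite addr0. Qed.
Fact afD_tr (f g : affFun) (a : A) (v : W) :
  f (atr a v) + g (atr a v) = f a + g a + (af_lin f v + af_lin g v).
Proof. by rewrite !af_tr addrACA. Qed.
Fact afZ_tr b (f : affFun) a v :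
  b * f (atr a v) = b * f a + b * af_lin f v.
Proof. by rewrite af_tr mulrDr. Qed.
Fact afN_tr (f : affFun) a v : - f (atr a v) = - f a + - af_lin f v.
Proof. by rewrite af_tr opprD. Qed.

Definition affFun0 := @AffFun (fun=> 0) (fun=> 0) af0_scalar af0_tr.
Definition affFunD (f g : affFun) := @AffFun (fun a => f a + g a)
  (fun v => af_lin f v + af_lin g v) (afD_scalar f g) (afD_tr f g).
Definition affFunN (f : affFun) := @AffFun (fun a => - f a)
  (fun v => - af_lin f v) (afN_scalar f) (afN_tr f).
Definition affFunZ (b : R) (f : affFun) := @AffFun (fun a => b * f a)
  (fun v => b * af_lin f v) (afZ_scalar b f) (afZ_tr b f).

Fact affFunDA : associative affFunD.
Proof. by move=> f g h; apply: affFun_eq => w; exact: addrA. Qed.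
Fact affFunDC : commutative affFunD.
Proof. by move=> f g; apply: affFun_eq => w; exact: addrC. Qed.
Fact affFun0D : left_id affFun0 affFunD.
Proof. by move=> f; apply: affFun_eq => w; exact: add0r. Qed.
Fact affFunND : left_inverse affFun0 affFunN affFunD.
Proof. by move=> f; apply: affFun_eq => w; exact: addNr. Qed.

HB.instance Definition _ := gen_eqMixin affFun.
HB.instance Definition _ := gen_choiceMixin affFun.
HB.instance Definition _ := GRing.isZmodule.Build affFun
  affFunDA affFunDC affFun0D affFunND.

Fact affFunZA a b f : affFunZ a (affFunZ b f) = affFunZ (a * b) f.
Proof. by apply: affFun_eq => w; exact: mulrA. Qed.
Fact affFun1Z : left_id 1 affFunZ.
Proof. by move=> f; apply: affFun_eq => w; exact: mul1r. Qed.
Fact affFunZDr : right_distributive affFunZ +%R.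
Proof. by move=> a f g; apply: affFun_eq => w; exact: mulrDr. Qed.
Fact affFunZDl f : {morph affFunZ^~ f : a b / a + b}.
Proof. by move=> a b; apply: affFun_eq => w; exact: mulrDl. Qed.

HB.instance Definition _ := GRing.Zmodule_isLmodule.Build R affFun
  affFunZA affFun1Z affFunZDr affFunZDl.
End affine_functions.


(* A smooth manifold given by a smooth atlas.  The maps [cinv c] are only
   meaningful on the open set [cmap c @` cdom c]; [chart_at] selects a
   distinguished chart around each point. *)
Record manifold (R : realType) := Manifold {
  mcarrier :> topologicalType ;
  mdim : nat ;
  chart : Type ;
  cdom : chart -> set mcarrier ;
  cmap : chart -> mcarrier -> 'rV[R]_mdim ;
  cinv : chart -> 'rV[R]_mdim -> mcarrier ;
  chart_at : mcarrier -> chart ;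
  m_hausdorff : hausdorff_space mcarrier ;
  m_second_countable : @second_countable mcarrier ;
  cdom_open : forall c, open (cdom c) ;
  cimg_open : forall c, open (cmap c @` cdom c) ;
  cmapK : forall c m, cdom c m -> cinv c (cmap c m) = m ;
  cmap_continuous : forall c m, cdom c m -> {for m, continuous (cmap c)} ;
  cinv_continuous : forall c x, (cmap c @` cdom c) x ->
    {for x, continuous (cinv c)} ;
  cmap_compat : forall c d,
    is_smooth (cmap c @` (cdom d `&` cdom c)) (cmap d \o cinv c) ;
  chart_atP : forall m, cdom (chart_at m) m
}.

Section smooth_maps.
Context {R : realType} (M : manifold R).

Definition smooth_on {W : normedModType R} (U : set M) (f : M -> W) : Prop :=
  forall c : chart M, is_smooth (cmap c @` (U `&` cdom c)) (f \o cinv c).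

Lemma chart_image_open (c : chart M) (U : set M) :
  open U -> open (cmap c @` (U `&` cdom c)).
Proof.
move=> oU; rewrite openE => _ [m [Um cm] <-].
have im : (cmap c @` cdom c) (cmap c m) by exists m.
have n1 : \forall x \near cmap c m, (cmap c @` cdom c) x.
  by apply: open_nbhs_nbhs; split => //; exact: cimg_open.
have n2 : \forall x \near cmap c m, U (cinv c x).
  apply: (cinv_continuous im); rewrite cmapK //.
  by apply: open_nbhs_nbhs; split.
rewrite /interior; apply: filterS2 n1 n2 => _ [p cp <-].
by rewrite cmapK // => Up; exists p.
Qed.

Lemma smooth_on_cst {W : normedModType R} (U : set M) (a : W) : smooth_on U (fun=> a).
Proof. by move=> c k; exact: Ck_cst. Qed.

Section closure.
Context {W : normedModType R}.
Implicit Types (f g : M -> W) (U : set M).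

Lemma smooth_on_ext U f g :
  open U -> (forall m, U m -> f m = g m) -> smooth_on U f -> smooth_on U g.
Proof.
move=> oU fg sf c k; apply: Ck_ext (sf c k); first exact: chart_image_open.
by move=> x; rewrite inE => -[m [Um cm] <-] /=; rewrite cmapK // fg.
Qed.

Lemma smooth_onS U U' f : U `<=` U' -> smooth_on U' f -> smooth_on U f.
Proof.
move=> UU' sf c k; apply: CkS (sf c k).
by move=> _ [m [/UU' Um cm] <-]; exists m.
Qed.

Lemma smooth_on_local U f :
  (forall m, U m -> exists2 B, B m & smooth_on B f) -> smooth_on U f.
Proof.
move=> H c k; apply: Ck_bigcup => _ [m [/H[B Bm sB] cm] <-].
by exists (cmap c @` (B `&` cdom c)); [exists m|exact: sB].
Qed.

Lemma smooth_onD U f g :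
  open U -> smooth_on U f -> smooth_on U g -> smooth_on U (fun m => f m + g m).
Proof.
move=> oU sf sg c k.
by apply: CkD (sf c k) (sg c k); exact: chart_image_open.
Qed.

Lemma smooth_on_scale U (a : M -> R) f :
  open U -> smooth_on U a -> smooth_on U f -> smooth_on U (fun m => a m *: f m).
Proof.
move=> oU sa sf c k.
by apply: Ck_scale (sa c k) (sf c k); exact: chart_image_open.
Qed.

Lemma smooth_onZ U (a : R) f :
  open U -> smooth_on U f -> smooth_on U (fun m => a *: f m).
Proof. by move=> oU; apply: smooth_on_scale => //; exact: smooth_on_cst. Qed.

Lemma smooth_onN U f : open U -> smooth_on U f -> smooth_on U (fun m => - f m).
Proof.
move=> oU sf; under eq_fun do rewrite -scaleN1r.
exact: smooth_onZ.
Qed.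

Lemma smooth_on_sum U I (r : seq I) (f : I -> M -> W) : open U ->
  (forall i, smooth_on U (f i)) ->
  smooth_on U (fun m => \sum_(i <- r) f i m).
Proof.
move=> oU sf c k; apply: (@Ck_sum _ _ _ k _ _ r (fun i => f i \o cinv c)).
  exact: chart_image_open.
by move=> i; exact: sf.
Qed.

Lemma smooth_on_cmap U (c : chart M) (h : 'rV[R]_(mdim M) -> W) :
  open U -> is_smooth (cmap c @` (U `&` cdom c)) h ->
  smooth_on (U `&` cdom c) (h \o cmap c).
Proof.
move=> oU sh d k.
have oUc : open (U `&` cdom c) by apply: openI => //; exact: cdom_open.
apply: (@Ck_comp _ _ _ _ _ _ (cmap c @` (U `&` cdom c)) (cmap c \o cinv d)).
- exact: chart_image_open.
- exact: chart_image_open.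
- by move=> _ [m [Um dm] <-] /=; rewrite cmapK //; exists m.
- apply: CkS (cmap_compat d c k).
  by move=> _ [m [[_ cm] dm] <-]; exists m.
- exact: sh.
Qed.

Lemma diff_chart U (f : M -> W) (c d : chart M) (m : M) :
  open U -> smooth_on U f -> U m -> cdom c m -> cdom d m ->
  'd (f \o cinv c) (cmap c m) =
  'd (f \o cinv d) (cmap d m) \o 'd (cmap d \o cinv c) (cmap c m)
  :> ('rV[R]_(mdim M) -> W).
Proof.
move=> oU sf Um cm dm.
have dcd : differentiable (cmap d \o cinv c) (cmap c m).
  by have [+ _] := cmap_compat c d 1; apply; exists m.
have dfc : differentiable (f \o cinv c) (cmap c m).
  by have [+ _] := sf c 1%N; apply; exists m.
have dfd : differentiable (f \o cinv d) ((cmap d \o cinv c) (cmap c m)).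
  by rewrite /= cmapK //; have [+ _] := sf d 1%N; apply; exists m.
have E : \forall x \near cmap c m,
    (f \o cinv c) x = ((f \o cinv d) \o (cmap d \o cinv c)) x.
  have oi : open (cmap c @` (cdom d `&` cdom c)).
    by apply: chart_image_open; exact: cdom_open.
  have := open_nbhs_nbhs (conj oi (ex_intro2 _ _ m (conj dm cm) erefl)).
  apply: filterS => _ [p [dp cp] <-] /=.
  by rewrite cmapK // cmapK.
apply/funext => v; transitivity
    ('D_v ((f \o cinv d) \o (cmap d \o cinv c)) (cmap c m)).
  rewrite -(deriveE v dfc); exact: near_eq_derive E.
have E2 := congr1 (@^~ v) (diff_comp dcd dfd).
have dcomp := differentiable_comp dcd dfd.
rewrite (deriveE v dcomp) [LHS]E2 [LHS]/comp.
have -> : (cmap d \o cinv c) (cmap c m) = cmap d m by rewrite /comp (cmapK cm).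
reflexivity.
Qed.
End closure.

Lemma smooth_on_coord U p (f : M -> 'rV[R]_p) j :
  open U -> smooth_on U f -> smooth_on U (fun m => f m 0 j : R).
Proof.
move=> oU sf c k.
exact: (@Ck_coord R _ p k _ (f \o cinv c) j (chart_image_open oU) (sf c k)).
Qed.

Lemma smooth_on_rV U p (f : M -> 'rV[R]_p) :
  open U -> (forall j, smooth_on U (fun m => f m 0 j : R)) -> smooth_on U f.
Proof.
move=> oU sf c k; apply: Ck_rV; first exact: chart_image_open.
by move=> j; exact: sf.
Qed.

Lemma smooth_on_chartmap (c : chart M) : smooth_on (cdom c) (cmap c).
Proof. by move=> d; exact: cmap_compat. Qed.

Lemma diff_chart_id (c : chart M) (m : M) (v : 'rV[R]_(mdim M)) :
  cdom c m -> 'd (cmap c \o cinv c) (cmap c m) v = v.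
Proof.
move=> cm.
have dc : differentiable (cmap c \o cinv c) (cmap c m).
  by have [+ _] := cmap_compat c c 1; apply; exists m.
have E : \forall x \near cmap c m, (cmap c \o cinv c) x = id x.
  have := open_nbhs_nbhs (conj (@cimg_open R M c) (ex_intro2 _ _ m cm erefl)).
  by apply: filterS => _ [p cp <-] /=; rewrite cmapK.
rewrite -(deriveE v dc); transitivity ('D_v id (cmap c m)).
  exact: near_eq_derive E.
exact: derive_id.
Qed.

Lemma linear_rV {W : lmodType R} p (G : 'rV[R]_p -> W) y :
  linear G -> G y = \sum_j y 0 j *: G (delta_mx 0 j).
Proof.
move=> lG; pose L : {linear 'rV[R]_p -> W} :=
  HB.pack G (GRing.isLinear.Build _ _ _ _ G lG).
rewrite {1}[y]row_sum_delta -[G]/(L : _ -> _) linear_sum.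
by apply: eq_bigr => j _; rewrite linearZ.
Qed.

Lemma smooth_on_linear {W : normedModType R} p U (G : M -> 'rV[R]_p -> W)
    (y : M -> 'rV[R]_p) :
  open U -> (forall m, U m -> linear (G m)) ->
  (forall v, smooth_on U (fun m => G m v)) -> smooth_on U y ->
  smooth_on U (fun m => G m (y m)).
Proof.
move=> oU lG sG sy.
apply: (@smooth_on_ext _ U
    (fun m => \sum_j y m 0 j *: G m (delta_mx 0 j))) => //.
  by move=> m Um; rewrite [RHS]linear_rV //; exact: lG.
apply: smooth_on_sum => // j; apply: smooth_on_scale => //.
exact: smooth_on_coord.
Qed.

(* A smooth real vector bundle of finite rank over M, given fibrewise by its
   local trivializations [vcoord c m : V m -> R^r], with inverse [vframe c m],
   for m in [vdom c].  Outside [vdom c] these maps carry no information;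
   [vcoord c m] is required to be linear there too (it may be zero). *)
Record vbundle := VBundle {
  vfib :> M -> lmodType R ;
  vtriv : Type ;
  vdom : vtriv -> set M ;
  vrank : vtriv -> nat ;
  vcoord : forall (c : vtriv) (m : M), vfib m -> 'rV[R]_(vrank c) ;
  vframe : forall (c : vtriv) (m : M), 'rV[R]_(vrank c) -> vfib m ;
  vdom_open : forall c, open (vdom c) ;
  vdom_cover : forall m, exists c, vdom c m ;
  vcoord_linear : forall c m, linear (@vcoord c m) ;
  vcoordK : forall c m, vdom c m -> cancel (@vcoord c m) (@vframe c m) ;
  vframeK : forall c m, vdom c m -> cancel (@vframe c m) (@vcoord c m) ;
  vtrans_smooth : forall c d y,
    smooth_on (vdom c `&` vdom d) (fun m => vcoord d (@vframe c m y))
}.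

Arguments vcoord {v} c {m} _.
Arguments vframe {v} c m _.

Lemma vframe_linear (V : vbundle) (c : vtriv V) m :
  vdom c m -> linear (@vframe V c m).
Proof.
move=> cm a u v; rewrite -{1}(vframeK cm u) -{1}(vframeK cm v).
by rewrite -(@vcoord_linear V c m) vcoordK.
Qed.

Record Cinf := MkCinf {
  cinf_fun :> M -> R ;
  cinf_smooth : smooth_on setT cinf_fun
}.

Record section (V : vbundle) := MkSection {
  sec_fun :> forall m, V m ;
  sec_smooth : forall c : vtriv V,
    smooth_on (vdom c) (fun m => vcoord c (sec_fun m))
}.

Lemma Cinf_eq (f g : Cinf) : f =1 g -> f = g.
Proof.
case: f g => f sf [g sg] /= /funext fg; subst g.
by congr MkCinf; exact: Prop_irrelevance.
Qed.

Lemma section_eq (V : vbundle) (s t : section V) :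
  (forall m, s m = t m) -> s = t.
Proof.
case: s t => s ss [t st] /= st'; have {}st' : s = t by apply: functional_extensionality_dep.
by subst t; congr MkSection; exact: Prop_irrelevance.
Qed.

Section Cinf_zmod.
Implicit Types f g : Cinf.

Definition Cinf_cst (a : R) := MkCinf (@smooth_on_cst R setT a).
Definition CinfD f g := MkCinf
  (smooth_onD openT (@cinf_smooth f) (@cinf_smooth g)).
Definition CinfN f := MkCinf (smooth_onN openT (@cinf_smooth f)).

Fact CinfDA : associative CinfD.
Proof. by move=> f g h; apply: Cinf_eq => m; exact: addrA. Qed.
Fact CinfDC : commutative CinfD.
Proof. by move=> f g; apply: Cinf_eq => m; exact: addrC. Qed.
Fact Cinf0D : left_id (Cinf_cst 0) CinfD.
Proof. by move=> f; apply: Cinf_eq => m; exact: add0r. Qed.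
Fact CinfND : left_inverse (Cinf_cst 0) CinfN CinfD.
Proof. by move=> f; apply: Cinf_eq => m; exact: addNr. Qed.

HB.instance Definition _ := gen_eqMixin Cinf.
HB.instance Definition _ := gen_choiceMixin Cinf.
HB.instance Definition _ := GRing.isZmodule.Build Cinf
  CinfDA CinfDC Cinf0D CinfND.
End Cinf_zmod.

Section section_lmod.
Variable V : vbundle.
Implicit Types s t : section V.

Fact section0_smooth (c : vtriv V) :
  smooth_on (vdom c) (fun m => vcoord c (0 : V m)).
Proof.
apply: (@smooth_on_ext _ _ (fun=> 0)); [exact: vdom_open| |exact: smooth_on_cst].
move=> m cm; have := @vcoord_linear V c m (-1) 0 0.
by rewrite !scaler0 addr0 scaleN1r addNr.
Qed.

Fact section_lin_smooth (a : Cinf) s t (c : vtriv V) :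
  smooth_on (vdom c) (fun m => vcoord c (a m *: s m + t m)).
Proof.
have oc := @vdom_open V c.
apply: (@smooth_on_ext _ _
    (fun m => a m *: vcoord c (s m) + vcoord c (t m))) => //.
  by move=> m cm; rewrite vcoord_linear.
apply: smooth_onD => //; last exact: sec_smooth.
apply: smooth_on_scale => //; last exact: sec_smooth.
by apply: smooth_onS (@cinf_smooth a).
Qed.

Definition section0 := MkSection section0_smooth.

Fact sectionD_smooth s t (c : vtriv V) :
  smooth_on (vdom c) (fun m => vcoord c (s m + t m)).
Proof.
have := section_lin_smooth (Cinf_cst 1) s t c.
by under eq_fun do rewrite /= scale1r.
Qed.

Fact section_scale_smooth (f : Cinf) s (c : vtriv V) :
  smooth_on (vdom c) (fun m => vcoord c (f m *: s m)).
Proof.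
have := section_lin_smooth f s section0 c.
by under eq_fun do rewrite /= addr0.
Qed.

Fact sectionN_smooth s (c : vtriv V) :
  smooth_on (vdom c) (fun m => vcoord c (- s m)).
Proof.
have := section_scale_smooth (Cinf_cst (-1)) s c.
by under eq_fun do rewrite /= scaleN1r.
Qed.

Definition sectionD s t := MkSection (sectionD_smooth s t).
Definition sectionN s := MkSection (sectionN_smooth s).

Definition section_scale (f : Cinf) s := MkSection (section_scale_smooth f s).

Fact sectionDA : associative sectionD.
Proof. by move=> s t u; apply: section_eq => m; exact: addrA. Qed.
Fact sectionDC : commutative sectionD.
Proof. by move=> s t; apply: section_eq => m; exact: addrC. Qed.
Fact section0D : left_id section0 sectionD.
Proof. by move=> s; apply: section_eq => m; exact: add0r. Qed.
Fact sectionND : left_inverse section0 sectionN sectionD.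
Proof. by move=> s; apply: section_eq => m; exact: addNr. Qed.

HB.instance Definition _ := gen_eqMixin (section V).
HB.instance Definition _ := gen_choiceMixin (section V).
HB.instance Definition _ := GRing.isZmodule.Build (section V)
  sectionDA sectionDC section0D sectionND.

Definition sectionZ (a : R) s : section V := section_scale (Cinf_cst a) s.

Fact sectionZA a b s : sectionZ a (sectionZ b s) = sectionZ (a * b) s.
Proof. by apply: section_eq => m; exact: scalerA. Qed.
Fact section1Z : left_id 1 sectionZ.
Proof. by move=> s; apply: section_eq => m; exact: scale1r. Qed.
Fact sectionZDr : right_distributive sectionZ +%R.
Proof. by move=> a s t; apply: section_eq => m; exact: scalerDr. Qed.
Fact sectionZDl s : {morph sectionZ^~ s : a b / a + b}.
Proof. by move=> a b; apply: section_eq => m; exact: scalerDl. Qed.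

HB.instance Definition _ := GRing.Zmodule_isLmodule.Build R (section V)
  sectionZA section1Z sectionZDr sectionZDl.
End section_lmod.

(* A smooth affine bundle modelled on V, given fibrewise by its local affine
   trivializations [acoord c m : E m -> R^r] with inverse [aframe c m], for m in
   [adom c]; the linear part [alin c m : V m -> R^r], with inverse [alinv c m],
   is a trivialization of V compatible with those of the vector bundle V.
   As above, only the values over [adom c] matter (off it, [acoord c m] may be
   constant and [alin c m] zero). *)
Record abundle (V : vbundle) := ABundle {
  afib :> forall m : M, affSpace (V m) ;
  atriv : Type ;
  adom : atriv -> set M ;
  arank : atriv -> nat ;
  acoord : forall (c : atriv) (m : M), afib m -> 'rV[R]_(arank c) ;
  aframe : forall (c : atriv) (m : M), 'rV[R]_(arank c) -> afib m ;
  alin : forall (c : atriv) (m : M), V m -> 'rV[R]_(arank c) ;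
  alinv : forall (c : atriv) (m : M), 'rV[R]_(arank c) -> V m ;
  adom_open : forall c, open (adom c) ;
  adom_cover : forall m, exists c, adom c m ;
  alin_linear : forall c m, linear (@alin c m) ;
  acoord_tr : forall c m (a : afib m) v,
    acoord c (atr a v) = acoord c a + alin c v ;
  acoordK : forall c m, adom c m -> cancel (@acoord c m) (@aframe c m) ;
  aframeK : forall c m, adom c m -> cancel (@aframe c m) (@acoord c m) ;
  alinK : forall c m, adom c m -> cancel (@alin c m) (@alinv c m) ;
  alinvK : forall c m, adom c m -> cancel (@alinv c m) (@alin c m) ;
  atrans_smooth : forall c d y,
    smooth_on (adom c `&` adom d) (fun m => acoord d (@aframe c m y)) ;
  alin_smooth : forall c (d : vtriv V) y,
    smooth_on (adom c `&` vdom d) (fun m => alin c (vframe d m y)) ;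
  alinv_smooth : forall c (d : vtriv V) y,
    smooth_on (adom c `&` vdom d) (fun m => vcoord d (@alinv c m y))
}.

Arguments acoord {V a} c {m} _ : rename.
Arguments aframe {V a} c m _ : rename.
Arguments alin {V a} c {m} _ : rename.
Arguments alinv {V a} c m _ : rename.

Lemma alinv_linear (V : vbundle) (E : abundle V) (c : atriv E) m :
  adom c m -> linear (@alinv V E c m).
Proof.
move=> cm a u v; rewrite -{1}(alinvK cm u) -{1}(alinvK cm v).
by rewrite -(@alin_linear V E c m) alinK.
Qed.

Lemma aframe_tr (V : vbundle) (E : abundle V) (c : atriv E) m y :
  adom c m -> aframe c m y = atr (aframe c m 0) (alinv c m y).
Proof.
move=> cm; rewrite -[RHS](acoordK cm) acoord_tr (aframeK cm) (alinvK cm).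
by rewrite add0r.
Qed.

Section asections.
Variables (V : vbundle) (E : abundle V).

Record asection := MkASection {
  asec_fun :> forall m, E m ;
  asec_smooth : forall c : atriv E,
    smooth_on (adom c) (fun m => acoord c (asec_fun m))
}.
Implicit Types (s t : asection) (v w : section V).

Lemma asection_eq s t : (forall m, s m = t m) -> s = t.
Proof.
case: s t => s ss [t st] /= st'.
have {}st' : s = t by apply: functional_extensionality_dep.
by subst t; congr MkASection; exact: Prop_irrelevance.
Qed.

Fact asec_tr_smooth s v (c : atriv E) :
  smooth_on (adom c) (fun m => acoord c (atr (s m) (v m))).
Proof.
have oc := @adom_open _ E c.
apply: (@smooth_on_ext _ _ (fun m => acoord c (s m) + alin c (v m))) => //.
  by move=> m cm; rewrite acoord_tr.
apply: smooth_onD => //; first exact: asec_smooth.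
apply: smooth_on_local => m cm; have [d dm] := @vdom_cover V m.
exists (adom c `&` vdom d) => //.
have ocd : open (adom c `&` vdom d) by apply: openI => //; exact: vdom_open.
apply: (@smooth_on_ext _ _ (fun m => alin c (vframe d m (vcoord d (v m))))) => //.
  by move=> p [_ dp]; rewrite vcoordK.
apply: (@smooth_on_linear _ _ _ (fun p y => alin c (vframe d p y))) => //.
- by move=> p [_ dp] a x y; rewrite vframe_linear // alin_linear.
- by move=> y; exact: alin_smooth.
- by apply: smooth_onS (@sec_smooth _ v d) => p [].
Qed.

Fact asec_sub_smooth s t (d : vtriv V) :
  smooth_on (vdom d) (fun m => vcoord d (asub (s m) (t m))).
Proof.
have od := @vdom_open V d.
apply: smooth_on_local => m dm; have [c cm] := @adom_cover _ E m.
exists (adom c `&` vdom d) => //.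
have ocd : open (adom c `&` vdom d) by apply: openI => //; exact: adom_open.
apply: (@smooth_on_ext _ _
  (fun m => vcoord d (alinv c m (acoord c (s m) - acoord c (t m))))) => //.
  move=> p [cp _]; congr (vcoord d _).
  rewrite -[in acoord c (s p)](asubK (s p) (t p)) acoord_tr addrC addKr.
  by rewrite (alinK cp).
apply: (@smooth_on_linear _ _ _ (fun p y => vcoord d (alinv c p y))) => //.
- by move=> p [cp _] a x y; rewrite alinv_linear // vcoord_linear.
- by move=> y; exact: alinv_smooth.
- apply: smooth_onD => //; last apply: smooth_onN => //.
  + by apply: smooth_onS (@asec_smooth s c) => p [].
  + by apply: smooth_onS (@asec_smooth t c) => p [].
Qed.

Definition asec_tr s v := MkASection (asec_tr_smooth s v).
Definition asec_sub s t := MkSection (asec_sub_smooth s t).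

Fact asec_tr0 s : asec_tr s 0 = s.
Proof. by apply: asection_eq => m; exact: atr0. Qed.
Fact asec_trD s v w : asec_tr (asec_tr s v) w = asec_tr s (v + w).
Proof. by apply: asection_eq => m; exact: atrD. Qed.
Fact asec_trK s v : asec_sub (asec_tr s v) s = v.
Proof. by apply: section_eq => m; exact: atrK. Qed.
Fact asec_subK s t : asec_tr t (asec_sub s t) = s.
Proof. by apply: asection_eq => m; exact: asubK. Qed.

Definition Sec : affSpace (section V) :=
  AffSpace asec_tr0 asec_trD asec_trK asec_subK.
End asections.

Section dual_bundle.
Variable V : vbundle.

Definition dcoord (c : vtriv V) (m : M) (z : dual (V m))
    : 'rV[R]_(vrank c) :=
  \row_j z (vframe c m (delta_mx 0 j)).

Fact dframe_scalar (c : vtriv V) (m : M) (y : 'rV[R]_(vrank c)) :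
  scalar (fun v : V m => \sum_j y 0 j * vcoord c v 0 j).
Proof.
move=> a u v; rewrite mulr_sumr -big_split /=; apply: eq_bigr => j _.
by rewrite vcoord_linear !mxE mulrDr mulrCA.
Qed.

Definition dframe (c : vtriv V) (m : M) (y : 'rV[R]_(vrank c)) : dual (V m) :=
  Dual (dframe_scalar y).

Arguments dcoord c {m} z.
Arguments dframe : clear implicits.

Fact dcoord_linear c m : linear (@dcoord c m).
Proof. by move=> a u v; apply/rowP => j; rewrite !mxE. Qed.

Fact dframeK c m : vdom c m -> cancel (@dframe c m) (@dcoord c m).
Proof.
move=> cm y; apply/rowP => j; rewrite mxE /= vframeK //.
rewrite (bigD1 j) //= mxE !eqxx mulr1 big1 ?addr0 // => i ij.
by rewrite mxE eqxx (negbTE ij) mulr0.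
Qed.

Fact dcoordK c m : vdom c m -> cancel (@dcoord c m) (@dframe c m).
Proof.
move=> cm z; apply: dual_eq => v /=.
have lG : linear ((z : V m -> R^o) \o @vframe V c m).
  by move=> a x y; rewrite /= vframe_linear // dual_scalar.
rewrite -{2}(vcoordK cm v); have /= -> := linear_rV (vcoord c v) lG.
by apply: eq_bigr => j _; rewrite mxE mulrC.
Qed.

Fact dtrans_smooth (c d : vtriv V) y :
  smooth_on (vdom c `&` vdom d) (fun m => dcoord d (dframe c m y)).
Proof.
have ocd : open (vdom c `&` vdom d) by apply: openI; exact: vdom_open.
apply: smooth_on_rV => // j; under eq_fun do rewrite mxE /=.
apply: smooth_on_sum => // i.
apply: (@smooth_onZ R) => //; apply: smooth_on_coord => //.
by rewrite setIC; exact: vtrans_smooth.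
Qed.

Definition dual_bundle : vbundle := {|
  vfib := fun m => dual (V m) ;
  vdom := @vdom V ;
  vrank := @vrank V ;
  vcoord := dcoord ;
  vframe := dframe ;
  vdom_open := @vdom_open V ;
  vdom_cover := @vdom_cover V ;
  vcoord_linear := dcoord_linear ;
  vcoordK := dcoordK ;
  vframeK := dframeK ;
  vtrans_smooth := dtrans_smooth
|}.
End dual_bundle.

(* The coordinates of an affine function on a fibre of E are its value at the
   origin of the trivialization and its linear part on the frame. *)
Section affine_dual.
Variables (V : vbundle) (E : abundle V).

Definition adcoord (c : atriv E) (m : M) (f : affFun (E m))
    : 'rV[R]_(1 + arank c) :=
  row_mx (f (aframe c m 0))%:M
         (\row_j af_lin f (alinv c m (delta_mx 0 j))).

Definition adlin (c : atriv E) (m : M) (y : 'rV[R]_(1 + arank c)) (v : V m) : R :=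
  \sum_j rsubmx y 0 j * alin c v 0 j.

Definition adfun (c : atriv E) (m : M) (y : 'rV[R]_(1 + arank c)) (a : E m) : R :=
  lsubmx y 0 0 + \sum_j rsubmx y 0 j * acoord c a 0 j.

Fact adlin_scalar c m y : scalar (@adlin c m y).
Proof.
move=> a u v; rewrite mulr_sumr -big_split /=; apply: eq_bigr => j _.
by rewrite alin_linear !mxE mulrDr mulrCA.
Qed.

Fact adfun_tr c m y (a : E m) v :
  adfun (c := c) y (atr a v) = adfun y a + adlin y v.
Proof.
rewrite /adfun -addrA -big_split /=; congr (_ + _); apply: eq_bigr => j _.
by rewrite acoord_tr !mxE mulrDr.
Qed.

Definition adframe (c : atriv E) (m : M) (y : 'rV[R]_(1 + arank c))
    : affFun (E m) :=
  AffFun (adlin_scalar y) (adfun_tr y).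

Arguments adcoord c {m} f.
Arguments adframe : clear implicits.

Fact adcoord_linear c m : linear (@adcoord c m).
Proof.
move=> a f g; rewrite /adcoord scale_row_mx add_row_mx; congr row_mx.
  by apply/rowP => j; rewrite !mxE mulrnDl mulrnAr.
by apply/rowP => j; rewrite !mxE.
Qed.

Fact adframeK c m : adom c m -> cancel (@adframe c m) (@adcoord c m).
Proof.
move=> cm y; rewrite -[RHS]hsubmxK; congr row_mx; apply/rowP => j.
  rewrite [j]ord1 mxE eqxx mulr1n /= /adfun (aframeK cm).
  by rewrite big1 ?addr0 // => i _; rewrite [X in _ * X]mxE mulr0.
rewrite mxE /= /adlin (alinvK cm) (bigD1 j) //= [X in _ * X + _]mxE !eqxx mulr1.
rewrite big1 ?addr0 // => i ij.
by rewrite [X in _ * X]mxE eqxx (negbTE ij) mulr0.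
Qed.

Fact adcoordK c m : adom c m -> cancel (@adcoord c m) (@adframe c m).
Proof.
move=> cm f.
have lin v : adlin (adcoord c f) v = af_lin f v.
  have lG : linear ((af_lin f : V m -> R^o) \o @alinv V E c m).
    by move=> a x y; rewrite /= alinv_linear // af_scalar.
  rewrite -{2}(alinK cm v); have /= -> := linear_rV (alin c v) lG.
  by apply: eq_bigr => j _; rewrite row_mxKr mxE mulrC.
apply: affFun_eq => [a|v] /=; last exact: lin.
rewrite -[a in RHS](asubK a (aframe c m 0)) af_tr -lin.
rewrite -{1}(asubK a (aframe c m 0)) adfun_tr; congr (_ + _).
rewrite /adfun row_mxKl mxE eqxx mulr1n (aframeK cm).
by rewrite big1 ?addr0 // => i _; rewrite [X in _ * X]mxE mulr0.
Qed.

Fact adtrans_smooth (c d : atriv E) y : smooth_on (adom c `&` adom d)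
  (fun m => adcoord d (adframe c m y)).
Proof.
have ocd : open (adom c `&` adom d) by apply: openI; exact: adom_open.
have sf x : smooth_on (adom c `&` adom d)
    (fun m => adfun y (aframe d m x) : R).
  apply: smooth_onD => //; first exact: smooth_on_cst.
  apply: smooth_on_sum => // i; apply: (@smooth_onZ R) => //.
  apply: smooth_on_coord => //; rewrite setIC; exact: atrans_smooth.
apply: smooth_on_rV => // j; rewrite /adcoord.
case: (split_ordP j) => {}j ->.
  apply: smooth_on_ext (sf 0) => // m _.
  by rewrite row_mxEl mxE (ord1 j) eqxx mulr1n.
apply: (@smooth_on_ext _ _
  (fun m => adfun y (aframe d m (delta_mx 0 j)) - adfun y (aframe d m 0))) => //.
  move=> m [_ dm]; rewrite row_mxEr mxE /=.
  by rewrite (aframe_tr _ dm) adfun_tr addrC addKr.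
by apply: smooth_onD => //; apply: smooth_onN.
Qed.

Definition affdual_bundle : vbundle := {|
  vfib := fun m => affFun (E m) ;
  vdom := @adom V E ;
  vrank := fun c => (1 + arank c)%N ;
  vcoord := adcoord ;
  vframe := adframe ;
  vdom_open := @adom_open V E ;
  vdom_cover := @adom_cover V E ;
  vcoord_linear := adcoord_linear ;
  vcoordK := adcoordK ;
  vframeK := adframeK ;
  vtrans_smooth := adtrans_smooth
|}.

Definition bidual : vbundle := dual_bundle affdual_bundle.
End affine_dual.

(* Fibrewise linear (resp. affine) maps, smooth in trivializations; since they
   are linear (resp. affine) in the fibre coordinates y, it is enough to ask for
   smoothness in the base point at each fixed y. *)
Record vbmap (V W : vbundle) := VBMap {
  vmap_fun :> forall m, V m -> W m ;
  vmap_linear : forall m, linear (@vmap_fun m) ;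
  vmap_smooth : forall (c : vtriv V) (d : vtriv W) y,
    smooth_on (vdom c `&` vdom d) (fun m => vcoord d (vmap_fun (vframe c m y)))
}.

Record abmap (V : vbundle) (E : abundle V) (W : vbundle) := ABMap {
  amap_fun :> forall m, E m -> W m ;
  amap_lin : forall m, V m -> W m ;
  amap_lin_linear : forall m, linear (@amap_lin m) ;
  amap_tr : forall m (a : E m) v,
    amap_fun (atr a v) = amap_fun a + amap_lin v ;
  amap_smooth : forall (c : atriv E) (d : vtriv W) y,
    smooth_on (adom c `&` vdom d) (fun m => vcoord d (amap_fun (aframe c m y)))
}.

Lemma vcoordD (V : vbundle) (c : vtriv V) m (u v : V m) :
  vcoord c (u + v) = vcoord c u + vcoord c v.
Proof. by rewrite -[u in LHS]scale1r vcoord_linear scale1r. Qed.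

Lemma vcoordB (V : vbundle) (c : vtriv V) m (u v : V m) :
  vcoord c (u - v) = vcoord c u - vcoord c v.
Proof.
by rewrite addrC -scaleN1r vcoord_linear scaleN1r addrC.
Qed.

Fact vmap_sec_smooth (V W : vbundle) (F : vbmap V W) (s : section V)
    (d : vtriv W) :
  smooth_on (vdom d) (fun m => vcoord d (F m (s m))).
Proof.
apply: smooth_on_local => m dm; have [c cm] := @vdom_cover V m.
exists (vdom c `&` vdom d) => //.
have ocd : open (vdom c `&` vdom d) by apply: openI; exact: vdom_open.
apply: (@smooth_on_ext _ _
    (fun m => vcoord d (F m (vframe c m (vcoord c (s m)))))) => //.
  by move=> p [cp _]; rewrite vcoordK.
apply: (@smooth_on_linear _ _ _ (fun p y => vcoord d (F p (vframe c p y)))) => //.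
- by move=> p [cp _] a x y; rewrite vframe_linear // vmap_linear vcoord_linear.
- by move=> y; exact: vmap_smooth.
- by apply: smooth_onS (@sec_smooth _ s c) => p [].
Qed.

Definition vmap_sec (V W : vbundle) (F : vbmap V W) (s : section V)
  : section W := MkSection (vmap_sec_smooth F s).

Section amap_theory.
Variables (V : vbundle) (E : abundle V) (W : vbundle) (F : abmap E W).

Fact amap_lin_frame_smooth (c : atriv E) (d : vtriv W) y :
  smooth_on (adom c `&` vdom d) (fun m => vcoord d (amap_lin F (alinv c m y))).
Proof.
have ocd : open (adom c `&` vdom d).
  by apply: openI; [exact: adom_open|exact: vdom_open].
apply: (@smooth_on_ext _ _ (fun m => vcoord d (F m (aframe c m y))
                                   - vcoord d (F m (aframe c m 0)))) => //.
  by move=> m [cm _]; rewrite -vcoordB (aframe_tr _ cm) amap_tr addrC addKr.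
apply: smooth_onD => //; last apply: smooth_onN => //; exact: amap_smooth.
Qed.

Fact amap_sec_smooth (s : Sec E) (d : vtriv W) :
  smooth_on (vdom d) (fun m => vcoord d (F m (s m))).
Proof.
apply: smooth_on_local => m dm; have [c cm] := @adom_cover _ E m.
exists (adom c `&` vdom d) => //.
have ocd : open (adom c `&` vdom d).
  by apply: openI; [exact: adom_open|exact: vdom_open].
apply: (@smooth_on_ext _ _ (fun m => vcoord d (F m (aframe c m 0)) +
    vcoord d (amap_lin F (alinv c m (acoord c (s m)))))) => //.
  move=> p [cp _]; rewrite -[s p in RHS](acoordK cp) (aframe_tr (acoord c (s p)) cp).
  by rewrite amap_tr vcoordD.
apply: smooth_onD => //; first exact: amap_smooth.
apply: (@smooth_on_linear _ _ _
    (fun p y => vcoord d (amap_lin F (alinv c p y)))) => //.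
- by move=> p [cp _] a x y; rewrite alinv_linear // amap_lin_linear vcoord_linear.
- by move=> y; exact: amap_lin_frame_smooth.
- by apply: smooth_onS (@asec_smooth _ _ s c) => p [].
Qed.

Definition amap_sec (s : Sec E) : section W := MkSection (amap_sec_smooth s).

Fact amap_linear_smooth (c : vtriv V) (d : vtriv W) y :
  smooth_on (vdom c `&` vdom d)
    (fun m => vcoord d (amap_lin F (vframe c m y))).
Proof.
apply: smooth_on_local => m [cm dm]; have [e em] := @adom_cover _ E m.
exists (adom e `&` (vdom c `&` vdom d)) => //.
have ocd : open (adom e `&` (vdom c `&` vdom d)).
  by do 2?apply: openI; [exact: adom_open|exact: vdom_open|exact: vdom_open].
apply: (@smooth_on_ext _ _ (fun m =>
    vcoord d (amap_lin F (alinv e m (alin e (vframe c m y)))))) => //.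
  by move=> p [ep _]; rewrite (alinK ep).
apply: (@smooth_on_linear _ _ _
    (fun p y => vcoord d (amap_lin F (alinv e p y)))) => //.
- by move=> p [ep _] a x z; rewrite alinv_linear // amap_lin_linear vcoord_linear.
- move=> z; apply: smooth_onS (@amap_lin_frame_smooth e d z).
  by move=> p [ep [_ dp]].
- apply: smooth_onS (@alin_smooth _ E e c y).
  by move=> p [ep [cp _]].
Qed.

Definition amap_linear : vbmap V W :=
  VBMap (@amap_lin_linear _ _ _ F) amap_linear_smooth.
End amap_theory.

Section canonical_immersion.
Variables (V : vbundle) (E : abundle V).

Fact eval_scalar m (a : E m) : scalar (fun f : affFun (E m) => f a).
Proof. by []. Qed.

Fact eval_lin_scalar m (v : V m) : scalar (fun f : affFun (E m) => af_lin f v).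
Proof. by []. Qed.

Definition immersion_fun m (a : E m) : bidual E m := Dual (eval_scalar a).
Definition immersion_lin m (v : V m) : bidual E m := Dual (eval_lin_scalar v).

Fact immersion_lin_linear m : linear (@immersion_lin m).
Proof. by move=> a u v; apply: dual_eq => f /=; rewrite af_scalar. Qed.

Fact immersion_tr m (a : E m) v :
  immersion_fun (atr a v) = immersion_fun a + immersion_lin v.
Proof. by apply: dual_eq => f /=; rewrite af_tr. Qed.

Fact immersion_smooth (c : atriv E) (d : vtriv (bidual E)) y :
  smooth_on (adom c `&` vdom d)
    (fun m => vcoord d (immersion_fun (aframe c m y))).
Proof.
have ocd : open (adom c `&` vdom d).
  by apply: openI; [exact: adom_open|exact: vdom_open].
apply: smooth_on_rV => // j; under eq_fun do rewrite mxE /=.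
apply: smooth_onD => //; first exact: smooth_on_cst.
apply: smooth_on_sum => // i; apply: (@smooth_onZ R) => //.
apply: smooth_on_coord => //; exact: (@atrans_smooth _ E c d y).
Qed.

Definition immersion : abmap E (bidual E) :=
  ABMap immersion_lin_linear immersion_tr immersion_smooth.
End canonical_immersion.

(* A tangent vector at m is represented by its components
   in the distinguished chart at m; its components in any other chart are
   obtained by applying the differential of the change of coordinates. *)
Definition tcoord (c : chart M) (m : M) (v : 'rV[R]_(mdim M)) : 'rV[R]_(mdim M) :=
  'd (cmap c \o cinv (chart_at m)) (cmap (chart_at m) m) v.

Definition tframe (c : chart M) (m : M) (v : 'rV[R]_(mdim M)) : 'rV[R]_(mdim M) :=
  'd (cmap (chart_at m) \o cinv c) (cmap c m) v.

Fact tcoord_linear c m : linear (@tcoord c m).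
Proof. by move=> a u v; rewrite /tcoord linearP. Qed.

Lemma diff_cocycle (c d e : chart M) (m : M) v :
  cdom c m -> cdom d m -> cdom e m ->
  'd (cmap e \o cinv d) (cmap d m) ('d (cmap d \o cinv c) (cmap c m) v) =
  'd (cmap e \o cinv c) (cmap c m) v.
Proof.
move=> cm dm em; have sf := @smooth_on_chartmap e.
have E := diff_chart (@cdom_open R M e) sf em cm dm.
exact: esym (congr1 (@^~ v) E).
Qed.

Fact tcoordK c m : cdom c m -> cancel (@tcoord c m) (@tframe c m).
Proof.
move=> cm v; rewrite /tcoord /tframe diff_cocycle //; try exact: chart_atP.
by apply: diff_chart_id; exact: chart_atP.
Qed.

Fact tframeK c m : cdom c m -> cancel (@tframe c m) (@tcoord c m).
Proof.
move=> cm v; rewrite /tcoord /tframe diff_cocycle //; try exact: chart_atP.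
exact: diff_chart_id.
Qed.

Fact ttrans_smooth (c d : chart M) y :
  smooth_on (cdom c `&` cdom d) (fun m => tcoord d m (tframe c m y)).
Proof.
have oc := @cdom_open R M c; have od := cdom_open d.
have ocd : open (cdom c `&` cdom d) by exact: openI.
apply: (@smooth_on_ext _ _
    ((fun x => 'D_y (cmap d \o cinv c) x) \o cmap c)) => //.
  move=> m [cm dm]; rewrite /tcoord /tframe diff_cocycle //; last exact: chart_atP.
  by rewrite /= deriveE //; have [+ _] := cmap_compat c d 1; apply; exists m.
rewrite setIC; apply: smooth_on_cmap => // k.
by have [_ +] := cmap_compat c d k.+1; apply.
Qed.

Definition TM : vbundle := {|
  vfib := fun=> 'rV[R]_(mdim M) ;
  vdom := @cdom R M ;
  vrank := fun=> mdim M ;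
  vcoord := tcoord ;
  vframe := tframe ;
  vdom_open := @cdom_open R M ;
  vdom_cover := fun m => ex_intro (fun c => cdom c m) _ (chart_atP m) ;
  vcoord_linear := tcoord_linear ;
  vcoordK := tcoordK ;
  vframeK := tframeK ;
  vtrans_smooth := ttrans_smooth
|}.

Definition lie_der_fun (X : section TM) (f : Cinf) (m : M) : R :=
  'd (f \o cinv (chart_at m)) (cmap (chart_at m) m) (X m).

Fact lie_der_smooth (X : section TM) (f : Cinf) :
  smooth_on setT (lie_der_fun X f).
Proof.
apply: smooth_on_local => m _; exists (cdom (chart_at m)); first exact: chart_atP.
set c := chart_at m; have oc := @cdom_open R M c.
have sf := @cinf_smooth f.
apply: (@smooth_on_ext _ _ (fun p => \sum_i tcoord c p (X p) 0 i *:
    ((fun x => 'D_(delta_mx 0 i) (f \o cinv c) x) \o cmap c) p)) => //.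
  move=> p cp; have pp := chart_atP p.
  rewrite /lie_der_fun (diff_chart openT sf I pp cp) /=.
  rewrite -/(tcoord c p (X p)) [X in 'd _ _ X]row_sum_delta linear_sum /=.
  apply: eq_bigr => i _; rewrite linearZ /= -deriveE //.
  by have [+ _] := sf c 1%N; apply; exists p.
apply: smooth_on_sum => // i; apply: smooth_on_scale => //.
  by apply: smooth_on_coord => //; exact: (@sec_smooth TM X c).
rewrite -[cdom c]setTI; apply: smooth_on_cmap; first exact: openT.
by move=> k; have [_ +] := sf c k.+1; apply.
Qed.

Definition lie_der (X : section TM) (f : Cinf) : Cinf :=
  MkCinf (lie_der_smooth X f).

End smooth_maps.

Notation "f *:: s" := (section_scale f s) (at level 40) : ring_scope.

Definition lie_bracket (R : realType) (W : lmodType R) (br : W -> W -> W) : Prop :=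
  [/\ forall u, linear (br u),
      forall u, linear (br^~ u),
      forall u, br u u = 0 &
      forall u v w, br u (br v w) + br v (br w u) + br w (br u v) = 0].

Definition aff_lie_structure (R : realType) (W : lmodType R) (A : affSpace W)
    (br : W -> W -> W) (D : A -> W -> W) : Prop :=
  [/\ lie_bracket br,
      forall a, linear (D a),
      forall a v w, D a (br v w) = br (D a v) w + br v (D a w) &
      forall a v w, D (atr a v) w = D a w + br v w].

Section lie_algebroids.
Context {R : realType} {M : manifold R}.

Record vLieAlgebroid (V : vbundle M) := VLieAlgebroid {
  vbr : section V -> section V -> section V ;
  vanchor : vbmap V (TM M) ;
  vbr_lie : lie_bracket vbr ;
  vbr_leibniz : forall (s t : section V) (f : Cinf M),
    vbr s (f *:: t) = lie_der (vmap_sec vanchor s) f *:: t + f *:: vbr s t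
}.

Record aLieAlgebroid (V : vbundle M) (E : abundle V) := ALieAlgebroid {
  abr : section V -> section V -> section V ;
  aD : Sec E -> section V -> section V ;
  aanchor : abmap E (TM M) ;
  aD_lie : aff_lie_structure abr aD ;
  aD_leibniz : forall (s : Sec E) (v : section V) (f : Cinf M),
    aD s (f *:: v) = lie_der (amap_sec aanchor s) f *:: v + f *:: aD s v
}.

(* The canonical immersion i and its linear part (the bold i), on sections. *)
Definition imm (V : vbundle M) (E : abundle V) (s : Sec E)
  : section (bidual E) := amap_sec (immersion E) s.

Definition immb (V : vbundle M) (E : abundle V) (v : section V)
  : section (bidual E) := vmap_sec (amap_linear (immersion E)) v.

Definition imm_bracket_closed (V : vbundle M) (E : abundle V)
    (A : vLieAlgebroid (bidual E)) : Prop :=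
  forall s t : Sec E, exists v : section V, vbr A (imm s) (imm t) = immb E v.

(* The restriction of A to E along the canonical immersions is B. *)
Definition induces (V : vbundle M) (E : abundle V)
    (A : vLieAlgebroid (bidual E)) (B : aLieAlgebroid E) : Prop :=
  [/\ forall v w : section V,
        immb E (abr B v w) = vbr A (immb E v) (immb E w),
      forall (s : Sec E) (v : section V),
        immb E (aD B s v) = vbr A (imm s) (immb E v) &
      forall s : Sec E,
        amap_sec (aanchor B) s = vmap_sec (vanchor A) (imm s)].

End lie_algebroids.

(* Main.v *)
Require Import Defs.
From HB Require Import structures.
From mathcomp Require Import all_boot all_order all_algebra.
From mathcomp Require Import all_classical all_reals all_analysis.
From mathcomp Require Import ring lra.
Set Implicit Arguments.
Unset Strict Implicit.
Unset Printing Implicit Defensive.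
Import Order.TTheory GRing.Theory Num.Theory numFieldNormedType.Exports.
Local Open Scope classical_set_scope.
Local Open Scope ring_scope.

(** Partitions of unity give global sections of E, so fix one, s.  Evaluation at
    the constant affine function 1 and the choice of s split the sections of the
    bidual as f i(s) + i(v), and s also writes every element of i(E) as
    i(s) + i(v).  For (1), everything to be closed under the bracket is therefore
    a difference of brackets of elements of i(Sec E), and the axioms for E follow
    from the injectivity of i.  For (2), take the displayed formulas as
    definitions: the Jacobi identity reduces to that of E together with the
    compatibility of the anchor with brackets, which is obtained by comparing
    the two expansions of D_s [v, f w] where V has positive rank and is trivial
    where V has rank 0. *)

(** * Smooth cut-off functions *)

(** Sections of an affine bundle cannot be multiplied by functions and summed, so the partition of
    unity takes the form of iterated affine interpolation between local sections: a weight equal to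
    1 near a point erases whatever was blended in beneath it, and a countable base makes the result
    a finite stage near each point. The weights come from [exp (-1/t)].

    The obstacle in (2) is the component of the Jacobi identity along i(s). It says that the anchor
    sends brackets to commutators of derivations, which is an axiom of neither structure. It is
    recovered by cancelling a vector v(m), hence needs a nonzero fibre at m. If the fibre is 0, then
    V vanishes near m and so does the linear part of the anchor, which makes both sides 0 even when
    one more derivative is taken.

    The formulas of (2) are claimed for every extension, not only for the one constructed; they are
    therefore derived from [induces] and the Leibniz rule. *)

Section smooth_calculus.
Context {R : realType}.

Lemma deriveZ1 (W : normedModType R) (f : R -> W) (x v : R) :
  differentiable f x -> 'D_v f x = v *: 'D_1 f x.
Proof.
by move=> df; rewrite !deriveE // -[v in LHS]mulr1 -[v * 1]/(v *: 1) linearZ.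
Qed.

(** In one variable all directional derivatives are multiples of the one along 1, so a single
    derivative function controls the class of f. *)
Lemma Ck_derive1 k (U : set R) (f f' : R -> R) :
  open U -> (forall x, U x -> is_derive x 1 f (f' x)) ->
  is_Ck k U f' -> is_Ck k.+1 U f.
Proof.
move=> oU df Cf'; have df1 x : U x -> differentiable f x.
  by move=> Ux; apply/derivable1_diffP; have [] := df _ Ux.
split=> // v; apply: (@Ck_ext _ _ _ _ _ (fun x => v *: f' x)) => //.
  by move=> x /[!inE] Ux; rewrite deriveZ1; [have [_ ->] := df _ Ux|exact: df1].
by apply: Ck_scale => //; exact: Ck_cst.
Qed.

Lemma Ck_comp1 (V W : normedModType R) k (U : set V) (O : set R)
    (f : V -> R) (g : R -> W) :
  open U -> open O -> (forall x, U x -> O (f x)) ->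
  is_Ck k U f -> is_Ck k O g -> is_Ck k U (g \o f).
Proof.
move=> oU oO fUO; elim: k g => [|k IHk] g.
  move=> cf cg x Ux; apply: continuous_comp; first exact: cf.
  by apply: cg; exact: fUO.
move=> Cf [dg Dg]; have [df Df] := Cf.
split=> [x Ux|v].
  by apply: differentiable_comp; [exact: df|exact: dg (fUO _ Ux)].
apply: (@Ck_ext _ _ _ _ _ (fun x => 'D_v f x *: 'D_1 g (f x))) => //; last first.
  apply: Ck_scale => //.
  - exact: Df.
  - exact: (IHk (fun y => 'D_1 g y) (CkW Cf) (Dg _)).
move=> x /[!inE] Ux.
have dfx := df x Ux; have dgx := dg _ (fUO x Ux).
rewrite [RHS]deriveE; last exact: differentiable_comp.
rewrite diff_comp //= -(deriveE _ dfx) -[RHS]deriveE //. by rewrite [RHS]deriveZ1.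
Qed.

Lemma Ck_mul (V : normedModType R) k (U : set V) (f g : V -> R) :
  open U -> is_Ck k U f -> is_Ck k U g -> is_Ck k U (fun x => f x * g x).
Proof. exact: (@Ck_scale R V R). Qed.

Lemma Ck_prod (V : normedModType R) k (U : set V) I (r : seq I)
    (f : I -> V -> R) :
  open U -> (forall i, is_Ck k U (f i)) ->
  is_Ck k U (fun x => \prod_(i <- r) f i x).
Proof.
move=> oU Hf; elim: r => [|i r IHr].
  by under eq_fun do rewrite big_nil; exact: Ck_cst.
by under eq_fun do rewrite big_cons; exact: Ck_mul.
Qed.

Lemma Ck_id k (U : set R) : is_Ck k U id.
Proof.
apply: (@Ck_linear R R R k U idfun) => x; exact: cvg_id.
Qed.

Lemma Ck_affine k (a b : R) : is_Ck k [set: R] (fun t => a + b * t).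
Proof.
have oT := @openT R; apply: CkD => //; first exact: Ck_cst.
by apply: Ck_mul => //; [exact: Ck_cst|exact: Ck_id].
Qed.

Lemma open_gt0 : open [set x : R | 0 < x].
Proof. exact: open_gt. Qed.

Lemma is_derive_inv (x : R) : x != 0 ->
  is_derive x 1 (@GRing.inv R) (- (x^-1 * x^-1)).
Proof.
move=> x0; apply: DeriveDef.
  by apply: derivableV => //; exact: derivable_id.
by rewrite deriveV // derive_id /GRing.scale /= mulr1 expr2 invfM.
Qed.

Lemma Ck_inv k : is_Ck k [set x : R | 0 < x] (@GRing.inv R).
Proof.
have oU := open_gt0; elim: k => [|k IHk].
  by move=> x /= x0; apply: inv_continuous; rewrite gt_eqF.
apply: (@Ck_derive1 _ _ _ (fun x => - (x^-1 * x^-1))) => //.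
  by move=> x /= x0; apply: is_derive_inv; rewrite gt_eqF.
have -> : (fun x : R => - (x^-1 * x^-1)) = (fun x => (-1) *: (x^-1 * x^-1)).
  by apply/funext => x; rewrite scaleN1r.
by apply: Ck_scale => //; [exact: Ck_cst|exact: Ck_mul].
Qed.

(** Only n = 0, the classical [exp (-1/t)], is wanted in the end; the powers of [1/t] are included
    because the family is then closed under differentiation up to linear combinations. *)
Definition flat n (t : R) : R :=
  if 0 < t then t^-1 ^+ n * expR (- t^-1) else 0.

Lemma flat_ge0 n t : 0 <= flat n t.
Proof.
rewrite /flat; case: ifP => // t0.
by rewrite mulr_ge0 ?expR_ge0 // exprn_ge0 // invr_ge0 ltW.
Qed.

(** From [exp x >= x^(n+1) / (n+1)!] at [x = 1/t]. A linear bound is enough: at 0 the difference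
    quotient of [flat n] is [flat n.+1], to which the bound applies again. *)
Lemma flat_le n t : flat n t <= n.+1`!%:R * `|t|.
Proof.
rewrite /flat; case: ifP => [t0|_]; last by rewrite mulr_ge0.
have tV0 : 0 < t^-1 by rewrite invr_gt0.
rewrite expRN ler_pdivrMr ?expR_gt0 // gtr0_norm //.
have := expR_ge1Dxn n (ltW tV0) => H.
apply: (@le_trans _ _ (n.+1`!%:R * t * (t^-1 ^+ n.+1 / n.+1`!%:R))); last first.
  rewrite ler_pM2l ?mulr_gt0 ?ltr0n ?fact_gt0 //; apply: le_trans H.
  by rewrite lerDr.
rewrite exprS le_eqVlt; apply/orP; left; apply/eqP.
by field; rewrite pnatr_eq0 -lt0n fact_gt0 gt_eqF.
Qed.

Lemma is_derive_flat n (t : R) :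
  is_derive t 1 (flat n) (flat n.+2 t - n%:R * flat n.+1 t).
Proof.
have [t0|t0|->] := ltgtP t 0.
- apply: (@near_eq_is_derive _ _ _ (cst 0)).
    near=> s; rewrite /flat ltNge ltW //=; near: s.
    by apply: open_nbhs_nbhs; split; [exact: open_lt|].
  by rewrite /flat ltNge ltW //= mulr0 subr0; exact: is_derive_cst.
- apply: (@near_eq_is_derive _ _ _ (fun s : R => s^-1 ^+ n * expR (- s^-1))).
    near=> s; rewrite /flat ifT //; near: s.
    by apply: open_nbhs_nbhs; split; [exact: open_gt0|].
  rewrite /flat t0.
  have dV : is_derive t 1 (fun s : R => s^-1) (- (t^-1 * t^-1)).
    by apply: is_derive_inv; rewrite gt_eqF.
  have dE : is_derive t 1 (fun s : R => expR (- s^-1))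
      (t^-1 * t^-1 * expR (- t^-1)).
    have dN : is_derive t 1 (fun s : R => - s^-1) (t^-1 * t^-1).
      by apply: is_derive_eq; rewrite opprK.
    have := @is_derive1_comp R expR (fun s => - s^-1) t _ _ (is_derive_expR _) dN.
    by rewrite mulrC.
  have dX : is_derive t 1 (fun s : R => s^-1 ^+ n)
      (- (n%:R * t^-1 ^+ n.+1)).
    have -> : (fun s : R => s^-1 ^+ n) = (fun s : R => s^-1) ^+ n.
      by apply/funext => s; rewrite exprfctE.
    apply: (is_derive_eq (@is_deriveX _ _ (fun s : R => s^-1) n t 1 _ dV)).
    case: (n) => [|m]; first by rewrite !mul0r oppr0 scale0r.
    by rewrite /GRing.scale /= !exprS; ring.
  have := @is_deriveM R R _ _ t 1 _ _ dX dE.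
  move=> h; apply: (is_derive_eq h).
  by rewrite /GRing.scale /= !exprS; ring.
- rewrite /flat ltxx mulr0 subr0.
  suff H : h^-1 *: ((flat n \o shift 0) (h *: 1) - flat n 0) @[h --> 0^'] --> (0:R).
    by apply: DeriveDef; [apply/cvg_ex; exists 0|exact: cvg_lim].
  apply: (@cvg_trans _ (flat n.+1 h @[h --> (0:R)^'])).
    apply: near_eq_cvg; near=> h.
    rewrite /= addr0 [_ *: 1]mulr1 /flat ltxx subr0 /GRing.scale /=.
    by case: ifP; rewrite ?mulr0 // exprS mulrA.
  apply: cvg_within_filter.
  apply: (@squeeze_cvgr _ _ _ _ (fun=> 0) (fun h => n.+2`!%:R * `|h|)).
  + by near=> h; rewrite flat_ge0 flat_le.
  + exact: cvg_cst.
  + rewrite -[X in _ --> X](mulr0 n.+2`!%:R); apply: cvgMr.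
    by rewrite -[X in _ --> X](normr0 R); apply: cvg_norm; exact: cvg_id.
Unshelve. all: by end_near. Qed.

(** The induction on k has to cover all n at once, since differentiation raises the index. *)
Lemma Ck_flat k n : is_Ck k [set: R] (flat n).
Proof.
elim: k n => [|k IHk] n.
  move=> x _; apply: differentiable_continuous; apply/derivable1_diffP.
  by have [] := is_derive_flat n x.
apply: Ck_derive1 => [|x _|]; [exact: openT|exact: is_derive_flat|].
have -> : (fun t : R => flat n.+2 t - n%:R * flat n.+1 t) =
    (fun t => flat n.+2 t + (- n%:R) *: flat n.+1 t).
  by apply/funext => t; rewrite /GRing.scale /= mulNr.
apply: CkD => //; first exact: openT.
by apply: Ck_scale => //; [exact: openT|exact: Ck_cst].
Qed.

(** The denominator is positive because t or 1 - t is. *)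
Definition smooth_step (t : R) : R := flat 0 t / (flat 0 t + flat 0 (1 - t)).

Lemma smooth_step0 t : t <= 0 -> smooth_step t = 0.
Proof. by move=> t0; rewrite /smooth_step /flat ltNge t0 mul0r. Qed.

Lemma smooth_step1 t : 1 <= t -> smooth_step t = 1.
Proof.
move=> t1; have t0 : 0 < t by exact: lt_le_trans t1.
rewrite /smooth_step /flat t0 subr_gt0 ltNge t1 /= addr0 expr0 mul1r.
by rewrite divff // gt_eqF ?expR_gt0.
Qed.

Lemma Ck_smooth_step k : is_Ck k [set: R] smooth_step.
Proof.
have oT := @openT R.
have Cd : is_Ck k [set: R] (fun t => flat 0 t + flat 0 (1 - t)).
  apply: CkD => //; first exact: Ck_flat.
  under eq_fun do rewrite -mulN1r.
  apply: (@Ck_comp1 _ _ _ _ setT (fun t : R => 1 + -1 * t) (flat 0)) => //.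
    exact: Ck_affine.
  exact: Ck_flat.
apply: Ck_mul => //; first exact: Ck_flat.
apply: (@Ck_comp1 _ _ _ _ [set x | 0 < x]
  (fun t => flat 0 t + flat 0 (1 - t)) GRing.inv) => //.
- move=> t _ /=; have [t0|t0] := ltP 0 t.
    by rewrite ltr_pwDl ?flat_ge0 // /flat t0 expr0 mul1r expR_gt0.
  rewrite ltr_wpDl ?flat_ge0 // /flat ifT ?expr0 ?mul1r ?expR_gt0 //; lra.
- exact: Ck_inv.
Qed.

Lemma rV_norm_leP p (x : 'rV[R]_p) (e : R) : 0 <= e ->
  reflect (forall j, `|x 0 j| <= e) (`|x| <= e).
Proof.
move=> e0; rewrite [`|x|]mx_normrE; apply: (iffP (bigmax_leP _ _ _ _)).
  by move=> [_ H] j; exact: (H (0, j)).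
by move=> H; split=> // -[i j] _ /=; rewrite (ord1 i).
Qed.

(** The norm of row vectors is the maximum norm, so a product of one-variable bumps over the
    coordinates works: within e every factor is 1, and beyond [2 * e] some factor is 0. *)
Lemma box_bump p (x0 : 'rV[R]_p) (e : R) : 0 < e ->
  exists h : 'rV[R]_p -> R, [/\ is_smooth setT h,
    forall x, `|x - x0| <= e -> h x = 1 &
    forall x, 2 * e < `|x - x0| -> h x = 0].
Proof.
(* [2 - t / e] is at least 1 for [t <= e] and negative for [t > 2 * e]; the second factor does the
   same for -t. *)
move=> e0; pose g (t : R) := smooth_step (2 + - e^-1 * t) * smooth_step (2 + e^-1 * t).
have Cg k : is_Ck k setT g.
  have oT := @openT R.
  apply: Ck_mul => //.
    apply: (@Ck_comp1 _ _ _ _ setT (fun t : R => 2 + - e^-1 * t) smooth_step) => //.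
      exact: Ck_affine.
    exact: Ck_smooth_step.
  apply: (@Ck_comp1 _ _ _ _ setT (fun t : R => 2 + e^-1 * t) smooth_step) => //.
    exact: Ck_affine.
  exact: Ck_smooth_step.
have g1 t : `|t| <= e -> g t = 1.
  rewrite ler_norml => /andP[t1 t2].
  have : e^-1 * t <= e^-1 * e by rewrite ler_pM2l ?invr_gt0.
  have : e^-1 * (- e) <= e^-1 * t by rewrite ler_pM2l ?invr_gt0.
  rewrite mulrN mulVf ?gt_eqF // => h1 h2.
  by rewrite /g !smooth_step1 ?mulr1 //; lra.
have g0 t : 2 * e < `|t| -> g t = 0.
  rewrite lter_normr => /orP[] h.
    have : e^-1 * (2 * e) < e^-1 * t by rewrite ltr_pM2l ?invr_gt0.
    rewrite mulrCA mulVf ?gt_eqF // => h1.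
    by rewrite /g smooth_step0 ?mul0r //; lra.
  have : e^-1 * (2 * e) < e^-1 * - t by rewrite ltr_pM2l ?invr_gt0.
  rewrite mulrN mulrCA mulVf ?gt_eqF // => h1.
  by rewrite /g [X in _ * X]smooth_step0 ?mulr0 //; lra.
exists (fun x => \prod_j g (x 0 j - x0 0 j)); split.
- move=> k; apply: Ck_prod => [|j]; first exact: openT.
  apply: (@Ck_comp1 _ _ _ _ setT (fun x : 'rV[R]_p => x 0 j - x0 0 j) g) => //;
    try exact: openT.
  apply: CkD; [exact: openT| |exact: Ck_cst].
  apply: (@Ck_coord _ _ _ _ _ id); first exact: openT.
  apply: (@Ck_linear R _ _ k _ idfun) => x; exact: cvg_id.
- move=> x hx; apply: big1 => j _; apply: g1.
  by have /(rV_norm_leP _ (ltW e0))/(_ j) := hx; rewrite !mxE.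
- move=> x hx.
  have [j hj] : exists j, 2 * e < `|x 0 j - x0 0 j|.
    apply: contrapT => /forallNP H.
    suff : `|x - x0| <= 2 * e by rewrite leNgt hx.
    apply/rV_norm_leP => [|j]; first by rewrite mulr_ge0 ?ltW.
    by rewrite !mxE leNgt; apply/negP; exact: H.
  by rewrite (bigD1 j) //= g0 // mul0r.
Qed.
End smooth_calculus.

(** * Bump functions on a manifold *)

Section bump.
Context {R : realType} {M : manifold R}.

Lemma manifold_bump (U : set M) (m : M) : open U -> U m ->
  exists (f : Cinf M) (C : set M), [/\ closed C, C `<=` U,
    forall x, ~ C x -> f x = 0 & \forall x \near m, f x = 1].
Proof.
move=> oU Um; set c := chart_at m; have cm : cdom c m := chart_atP m.
pose O := cmap c @` (U `&` cdom c); pose x0 := cmap c m.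
have oO : open O by exact: chart_image_open.
have /nbhs_ballP[e /= e0 eO] : nbhs x0 O.
  by apply: open_nbhs_nbhs; split=> //; exists m.
(* With e / 4 the bump lives in the closed ball of radius e / 2, strictly inside the ball of radius
   e contained in O. *)
have e40 : 0 < e / 4 by rewrite divr_gt0.
have [h [Ch h1 h0]] := box_bump x0 e40.
have r0 : 0 < 2 * (e / 4) by rewrite mulr_gt0.
pose K := closed_ball x0 (2 * (e / 4)).
have KE x : K x <-> `|x - x0| <= 2 * (e / 4).
  by rewrite /K closed_ballE // /closed_ball_ /= distrC.
have KO : K `<=` O.
  move=> x /KE hx; apply: eO; rewrite -ball_normE /= distrC.
  by apply: le_lt_trans hx _; lra.
pose C := cinv c @` K.
have cK : compact K.
  apply: bounded_closed_compact; last exact: closed_ball_closed.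
  exists (`|x0| + 2 * (e / 4)); split; first exact: num_real.
  move=> r hr x /KE hx; apply: le_trans (ltW hr).
  by rewrite -[x](subrK x0) addrC; apply: le_trans (ler_normD _ _) _; rewrite lerD2l.
have CU : C `<=` U `&` cdom c.
  by move=> _ [x /KO[p [Up cp] <-] <-]; rewrite cmapK.
(* C is compact and M is Hausdorff. Closedness is what makes the extension by 0 smooth: the chart
   domain and the complement of C form an open cover. *)
have cC : closed C.
  apply: compact_closed; first exact: m_hausdorff.
  apply: continuous_compact => //; apply: continuous_in_subspaceT => x.
  move=> /[!inE] /KO[p [Up cp] <-]; apply: cinv_continuous; by exists p.
pose f (p : M) : R := if p \in cdom c then h (cmap c p) else 0.
have f0 p : ~ C p -> f p = 0.
  move=> nC; rewrite /f; case: ifP => //; rewrite inE => cp; apply: h0.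
  rewrite ltNge; apply/negP => /KE Kp; apply: nC.
  by exists (cmap c p) => //; rewrite cmapK.
have oc := @cdom_open R M c.
have sf : smooth_on setT f.
  apply: smooth_on_local => p _; have [cp|cp] := pselect (cdom c p).
    exists (setT `&` cdom c) => //.
    apply: (@smooth_on_ext _ _ _ _ (h \o cmap c)); first exact: openI openT oc.
      by move=> q [_ cq]; rewrite /f ifT ?inE.
    apply: smooth_on_cmap; first exact: openT.
    by move=> k; apply: CkS (Ch k).
  exists (~` C); first by move=> /CU[].
  apply: (@smooth_on_ext _ _ _ _ (fun=> 0)); first exact: closed_openC.
    by move=> q /f0.
  exact: smooth_on_cst.
exists (MkCinf sf), C; split=> //; first by move=> x /CU[].
have n1 : \forall x \near m, cdom c x by apply: open_nbhs_nbhs.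
have n2 : \forall x \near m, `|cmap c x - x0| <= e / 4.
  have : \forall x \near m, ball x0 (e / 4) (cmap c x).
    by apply: (cmap_continuous cm); exact: nbhsx_ballx.
  apply: filterS => x; rewrite /= -ball_normE /= distrC; exact: ltW.
by apply: filterS2 n1 n2 => x cx hx; rewrite /= /f ifT ?inE // h1.
Qed.
End bump.

(** * Global sections *)

Arguments acoord {R M V a} c {m} _ : rename.
Arguments aframe {R M V a} c m _ : rename.
Arguments alin {R M V a} c {m} _ : rename.
Arguments alinv {R M V a} c m _ : rename.
Arguments vcoord {R M v} c {m} _ : rename.
Arguments vframe {R M v} c m _ : rename.

Section global_section.
Context {R : realType} {M : manifold R} {V : vbundle M} (E : abundle V).

(** Smoothness near one point of a merely set-theoretic section: the sections being blended are
    smooth only where their weight matters. *)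
Definition asmooth_at (s : forall m, E m) (x : M) : Prop :=
  exists2 B : set M, open B /\ B x &
    forall c : atriv E, smooth_on (B `&` adom c) (fun m => acoord c (s m)).

Lemma asmooth_at_near (s t : forall m, E m) (x : M) :
  (\forall y \near x, s y = t y) -> asmooth_at s x -> asmooth_at t x.
Proof.
move=> st [B [oB Bx] sB].
exists ((fun y => s y = t y)^° `&` B).
  by split; [apply: openI => //; exact: open_interior|split].
move=> c; have oI : open ((fun y => s y = t y)^° `&` B `&` adom c).
  by do 2?apply: openI => //; [exact: open_interior|exact: adom_open].
apply: (@smooth_on_ext _ _ _ _ (fun m => acoord c (s m))) => //.
  by move=> m [[/interior_subset -> _] _].
by apply: smooth_onS (sB c) => m [[_ ?] ?].
Qed.

Definition blend (f : Cinf M) (s t : forall m, E m) (m : M) : E m :=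
  atr (t m) (f m *: asub (s m) (t m)).

Lemma blend1 (f : Cinf M) (s t : forall m, E m) m : f m = 1 -> blend f s t m = s m.
Proof. by move=> fm; rewrite /blend fm scale1r asubK. Qed.

Lemma blend0 (f : Cinf M) (s t : forall m, E m) m : f m = 0 -> blend f s t m = t m.
Proof. by move=> fm; rewrite /blend fm scale0r atr0. Qed.

Lemma blend_smooth_at (f : Cinf M) (s t : forall m, E m) x :
  asmooth_at s x -> asmooth_at t x -> asmooth_at (blend f s t) x.
Proof.
move=> [B [oB Bx] sB] [C [oC Cx] tC]; exists (B `&` C).
  by split; [exact: openI|].
move=> c; have oI : open (B `&` C `&` adom c).
  by do 2?apply: openI => //; exact: adom_open.
have sB' : smooth_on (B `&` C `&` adom c) (fun m => acoord c (s m)).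
  by apply: smooth_onS (sB c) => m [[? ?] ?].
have tC' : smooth_on (B `&` C `&` adom c) (fun m => acoord c (t m)).
  by apply: smooth_onS (tC c) => m [[? ?] ?].
apply: (@smooth_on_ext _ _ _ _ (fun m => acoord c (t m) +
    f m *: (acoord c (s m) - acoord c (t m)))) => //.
  move=> m _; rewrite /blend acoord_tr; congr (_ + _).
  rewrite -[in acoord c (s m)](asubK (s m) (t m)) acoord_tr addrC addKr.
  have := @alin_linear _ _ _ E c m (f m) (asub (s m) (t m)) 0.
  have := @alin_linear _ _ _ E c m (-1) 0 0.
  by rewrite !scaler0 !addr0 scaleN1r addNr => -> ->; rewrite addr0.
apply: smooth_onD => //; apply: smooth_on_scale => //.
  by apply: smooth_onS (@cinf_smooth _ _ f).
by apply: smooth_onD => //; exact: smooth_onN.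
Qed.

Lemma aframe_smooth_at (c : atriv E) (b : forall m, E m) (x : M) :
  adom c x -> asmooth_at (fun m => if m \in adom c then aframe c m 0 else b m) x.
Proof.
move=> cx; exists (adom c); first by split=> //; exact: adom_open.
move=> d; have oI : open (adom c `&` adom d) by apply: openI; exact: adom_open.
apply: (@smooth_on_ext _ _ _ _ (fun m => acoord d (aframe c m 0))) => //.
  by move=> m [cm _]; rewrite ifT ?inE.
exact: atrans_smooth.
Qed.

(* Iterated blending stabilizes: wherever [f k = 1], the blend no longer
   depends on the sections of index larger than k. *)
Lemma exists_global_section : inhabited (Sec E).
Proof.
have b : forall m, E m.
  by move=> m; have [c _] := cid (@adom_cover _ _ _ E m); exact: aframe c m 0.
(* Under P, blending with [fs] either interpolates with a section smooth at x or changes nothing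
   near x. *)
pose P (fs : Cinf M * (forall m, E m)) := forall x,
  asmooth_at fs.2 x \/ \forall y \near x, fs.1 y = 0.
have Pb : P (Cinf_cst _ 0, b) by move=> x; right; exact: nearW.
have [B /countable_injP[idx idxI] bB] := @m_second_countable _ M.
pose good (U : set M) fs := P fs /\ forall y, U y -> fs.1 y = 1.
(* The index of a basic open set U receives a pair with weight 1 on U whenever one exists; every
   other index receives weight 0. *)
have /choice[F FP] : forall k : nat, exists fs, P fs /\
    forall U, B U -> idx U = k -> (exists fs', good U fs') -> good U fs.
  move=> k; have [[U [BU Uk [fs fsg]]]|] :=
    pselect (exists U, [/\ B U, idx U = k & exists fs, good U fs]).
    exists fs; split; first by case: fsg.
    move=> U' BU' U'k _; suff -> : U' = U by [].
    by apply: idxI; rewrite ?inE // U'k.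
  move=> H; exists (Cinf_cst _ 0, b); split=> // U BU Uk eU.
  by exfalso; apply: H; exists U.
have cover (x : M) : exists k, \forall y \near x, (F k).1 y = 1.
  have [c cx] := @adom_cover _ _ _ E x.
  have [f [C [cC Cc f0 f1]]] := manifold_bump (@adom_open _ _ _ E c) cx.
  have [_ /(_ x _ f1)[U [BU Ux] Uf]] := bB.
  exists (idx U); have [_ /(_ U BU erefl)[|PF F1]] := FP (idx U).
    exists (f, fun m => if m \in adom c then aframe c m 0 else b m); split=> //.
    move=> y; have [Cy|Cy] := pselect (C y).
      by left; apply: aframe_smooth_at; exact: Cc.
    right; apply: filterS (open_nbhs_nbhs (conj (closed_openC cC) Cy)).
    by move=> z; exact: f0.
  by apply: filterS (open_nbhs_nbhs (conj (bB.1 _ BU) Ux)).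
(* Index 0 is the outermost blend, so passing to a larger n only replaces the innermost seed b. *)
pose T n := foldr (fun k t => blend (F k).1 (F k).2 t) b (iota 0 n).
have Tstab (x : M) k n : (F k).1 x = 1 -> (k < n)%N -> T n x = T k.+1 x.
  move=> Fk kn; rewrite /T -(subnKC kn) iotaD foldr_cat.
  set t := foldr _ b _; have : k \in iota 0 k.+1 by rewrite mem_iota add0n ltnSn.
  elim: (iota 0 k.+1) => //= j ks IH; rewrite inE => /predU1P[<-|/IH e].
    by rewrite !blend1.
  by rewrite /blend e.
have Tsmooth (x : M) k : (\forall y \near x, (F k).1 y = 1) -> asmooth_at (T k.+1) x.
  move=> Fk; have : k \in iota 0 k.+1 by rewrite mem_iota add0n ltnSn.
  rewrite /T; elim: (iota 0 k.+1) => //= j ks IH; rewrite inE => /predU1P[jk|kks].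
    rewrite -jk; apply: (@asmooth_at_near (F k).2).
      by apply: filterS Fk => y Fy; rewrite blend1.
    have [/(_ x)[]// F0 _] := FP k; exfalso.
    have := nbhs_singleton F0; rewrite (nbhs_singleton Fk).
    by move/eqP; rewrite oner_eq0.
  have [/(_ x)[Fj|Fj] _] := FP j; first exact: blend_smooth_at Fj (IH kks).
  apply: asmooth_at_near (IH kks).
  by apply: filterS Fj => y Fy; rewrite blend0.
have /choice[K KP] : forall x : M, exists k, (F k).1 x = 1.
  by move=> x; have [k /nbhs_singleton Fk] := cover x; exists k.
(* [K] is chosen without any regularity in x; [Tstab] removes the dependence on the choice by
   comparing two indices at a common later stage. *)
pose s x := T (K x).+1 x.
have ss x : asmooth_at s x.
  have [k Fk] := cover x; apply: asmooth_at_near (Tsmooth x k Fk).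
  apply: filterS Fk => y Fy; rewrite /s.
  have lt1 : (k < maxn k.+1 (K y).+1)%N by rewrite leq_max ltnSn.
  have lt2 : (K y < maxn k.+1 (K y).+1)%N by rewrite leq_max ltnSn orbT.
  by rewrite -(Tstab _ _ _ Fy lt1) (Tstab _ _ _ (KP y) lt2).
have sS c : smooth_on (adom c) (fun m => acoord c (s m)).
  apply: smooth_on_local => m cm; have [B' [_ B'm] sB] := ss m.
  by exists (B' `&` adom c) => //; exact: sB.
by constructor; exact: MkASection sS.
Qed.
End global_section.

(** * Lie derivatives *)

Section values.
Context {R : realType} {M : manifold R}.

(** A local section with constant coordinates is cut off by a bump function and extended by 0. This
    passes from identities of sections to identities in each fibre. *)
Lemma section_through (V : vbundle M) (m : M) (v : V m) :
  exists s : section V, s m = v.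
Proof.
have [c cm] := @vdom_cover _ _ V m; have oc := @vdom_open _ _ V c.
have [f [C [cC Cc f0 /nbhs_singleton f1]]] := manifold_bump oc cm.
pose s p : V p := if p \in vdom c then f p *: vframe c p (vcoord c v) else 0.
have sS d : smooth_on (vdom d) (fun p => vcoord d (s p)).
  apply: smooth_on_local => p dp; have od := @vdom_open _ _ V d.
  have [cp|cp] := pselect (vdom c p).
    exists (vdom c `&` vdom d) => //; have oI := openI oc od.
    apply: (@smooth_on_ext _ _ _ _
        (fun p => f p *: vcoord d (vframe c p (vcoord c v)))) => //.
      move=> q [cq dq]; rewrite /s ifT ?inE //.
      have := @vcoord_linear _ _ V d q (f q) (vframe c q (vcoord c v)) 0.
      have := @vcoord_linear _ _ V d q (-1) 0 0.
      by rewrite !scaler0 !addr0 scaleN1r addNr => -> ->; rewrite addr0.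
    apply: smooth_on_scale => //; first by apply: smooth_onS (@cinf_smooth _ _ f).
    exact: vtrans_smooth.
  have oCd : open (~` C `&` vdom d) by apply: openI => //; exact: closed_openC.
  exists (~` C `&` vdom d); first by split=> // /Cc.
  apply: (@smooth_on_ext _ _ _ _ (fun q => vcoord d (section0 V q))) => //.
    move=> q [nCq _] /=; congr (vcoord d _).
    by rewrite /s; case: ifP => // _; rewrite f0 // scale0r.
  by apply: smooth_onS (@sec_smooth _ _ V (section0 V) d) => q [].
exists (MkSection sS) => /=.
by rewrite /s ifT ?inE // f1 scale1r vcoordK.
Qed.

Lemma asection_through (V : vbundle M) (E : abundle V) (m : M) (a : E m) :
  exists s : Sec E, s m = a.
Proof.
have [s] := exists_global_section E.
have [v vm] := section_through (asub a (s m)).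
by exists (asec_tr s v); rewrite /= vm asubK.
Qed.
End values.

Section evaluation.
Context {R : realType} {M : manifold R} {V : vbundle M}.
Implicit Types (s t : section V) (m : M).

Lemma sectionDE s t m : (s + t) m = s m + t m.
Proof. by []. Qed.

Lemma sectionNE s m : (- s) m = - s m.
Proof. by []. Qed.

Lemma sectionZE a s m : (a *: s) m = a *: s m.
Proof. by []. Qed.

Lemma section_scaleE (f : Cinf M) s m : (f *:: s) m = f m *: s m.
Proof. by []. Qed.
End evaluation.

Section lie_derivative.
Context {R : realType} {M : manifold R}.
Implicit Types (X Y : section (TM M)) (f g : Cinf M).

Definition CinfM f g : Cinf M := MkCinf
  (@smooth_on_scale _ _ R setT f g openT (@cinf_smooth _ _ f) (@cinf_smooth _ _ g)).

Lemma Cinf_cstE a m : Cinf_cst M a m = a.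
Proof. by []. Qed.

Lemma CinfDE f g m : (f + g) m = f m + g m.
Proof. by []. Qed.

Lemma CinfNE f m : (- f) m = - f m.
Proof. by []. Qed.

Lemma CinfME f g m : CinfM f g m = f m * g m.
Proof. by []. Qed.

Lemma lie_der_diffE X f m : lie_der X f m =
  'd (f \o cinv (chart_at m)) (cmap (chart_at m) m) (X m).
Proof. by []. Qed.

Lemma lie_derE X f m : lie_der X f m =
  'D_(X m) (f \o cinv (chart_at m)) (cmap (chart_at m) m).
Proof.
rewrite deriveE //; have [+ _] := @cinf_smooth _ _ f (chart_at m) 1%N; apply.
by exists m => //; split=> //; exact: chart_atP.
Qed.

Lemma cinf_derivable f m v :
  derivable (f \o cinv (chart_at m)) (cmap (chart_at m) m) v.
Proof.
apply: diff_derivable; have [+ _] := @cinf_smooth _ _ f (chart_at m) 1%N; apply.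
by exists m => //; split=> //; exact: chart_atP.
Qed.

Lemma lie_derD X f g m : lie_der X (f + g) m = lie_der X f m + lie_der X g m.
Proof. by rewrite !lie_derE -deriveD //; exact: cinf_derivable. Qed.

Lemma lie_derN X f m : lie_der X (- f) m = - lie_der X f m.
Proof. by rewrite !lie_derE -deriveN //; exact: cinf_derivable. Qed.

Lemma lie_derM X f g m :
  lie_der X (CinfM f g) m = lie_der X f m * g m + f m * lie_der X g m.
Proof.
have := @deriveM _ _ (f \o cinv (chart_at m)) (g \o cinv (chart_at m)) _ _
  (@cinf_derivable f m (X m)) (@cinf_derivable g m (X m)).
rewrite !lie_derE /= cmapK; last exact: chart_atP.
by rewrite /GRing.scale /= addrC [g m * _]mulrC.
Qed.

Lemma lie_der_cst X a m : lie_der X (Cinf_cst M a) m = 0.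
Proof. by rewrite lie_derE; exact: derive_cst. Qed.

Lemma lie_der_scale X a f m :
  lie_der X (CinfM (Cinf_cst M a) f) m = a * lie_der X f m.
Proof. by rewrite lie_derM lie_der_cst mul0r add0r. Qed.

(** The hypothesis concerns values at m only, so the lemma also serves for combinations of fields
    with function coefficients. *)
Lemma lie_der_linear X Y f a m (Z : section (TM M)) :
  Z m = a *: X m + Y m ->
  lie_der Z f m = a * lie_der X f m + lie_der Y f m.
Proof. by rewrite /lie_der /= /lie_der_fun => ->; rewrite linearP. Qed.

Lemma lie_der_near0 X f m : (\forall p \near m, f p = 0) -> lie_der X f m = 0.
Proof.
move=> f0; rewrite lie_derE; set c := chart_at m.
have cm : cdom c m := chart_atP m.
have nf : \forall x \near cmap c m, (f \o cinv c) x = (cst 0 : _ -> R) x.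
  have im : (cmap c @` cdom c) (cmap c m) by exists m.
  suff : \forall x \near cmap c m, [set p | f p = 0] (cinv c x) by [].
  by apply: (cinv_continuous im); rewrite cmapK.
by rewrite (near_eq_derive _ nf); exact: derive_cst.
Qed.

End lie_derivative.

(** * Sections of the bidual *)

Section bidual_decomposition.
Context {R : realType} {M : manifold R} {V : vbundle M} {E : abundle V}.
Local Notation bi := (@immersion_lin R M V E _).
Local Notation ii := (@immersion_fun R M V E _).

Fact aff1_scalar (m : M) : scalar (fun _ : V m => 0 : R).
Proof. by move=> a u v; rewrite mulr0 addr0. Qed.
Fact aff1_tr (m : M) (a : E m) (v : V m) : (1 : R) = 1 + 0.
Proof. by rewrite addr0. Qed.

Definition aff1 (m : M) : affFun (E m) := AffFun (@aff1_scalar m) (@aff1_tr m).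

(** The first vector of the frame of affine functions attached to c is the constant function 1,
    whatever c is. *)
Lemma vcoord_lshift (c : atriv E) m (z : bidual E m) :
  vcoord (c : vtriv (bidual E)) z 0 (lshift _ 0) = z (aff1 m).
Proof.
rewrite mxE; congr (dual_fun z _); apply: affFun_eq => a /=.
  rewrite /adfun big1 ?addr0 => [|j _]; first by rewrite !mxE !eqxx.
  by rewrite !mxE eqxx eq_rlshift mul0r.
by rewrite /adlin big1 // => j _; rewrite !mxE eqxx eq_rlshift mul0r.
Qed.

Lemma vcoord_rshift (c : atriv E) m (z : bidual E m) j :
  vcoord (c : vtriv (bidual E)) z 0 (rshift _ j) =
  z (adframe m (c := c) (delta_mx 0 (rshift 1 j))).
Proof. by rewrite mxE. Qed.

Lemma adframe_lin (c : atriv E) m (v : V m) j :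
  af_lin (adframe m (c := c) (delta_mx 0 (rshift 1 j))) v = alin c v 0 j.
Proof.
rewrite /= /adlin (bigD1 j) //= !mxE !eqxx mul1r big1 ?addr0 // => i ij.
by rewrite !mxE eqxx eq_rshift (negbTE ij) mul0r.
Qed.

Lemma adframe_fun (c : atriv E) m (a : E m) j :
  adframe m (c := c) (delta_mx 0 (rshift 1 j)) a = acoord c a 0 j.
Proof.
rewrite /= /adfun !mxE eqxx eq_lrshift add0r.
rewrite (bigD1 j) //= !mxE !eqxx mul1r big1 ?addr0 // => i ij.
by rewrite !mxE eqxx eq_rshift (negbTE ij) mul0r.
Qed.

Lemma immersion_lin_inj m : injective (@immersion_lin R M V E m).
Proof.
move=> u v uv; have [c cm] := @adom_cover _ _ _ E m.
rewrite -(alinK cm u) -(alinK cm v); congr (alinv c m _); apply/rowP => j.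
rewrite -!adframe_lin.
set phi := adframe _ _.
exact: (congr1 (fun z : bidual E m => dual_fun z phi) uv).
Qed.

(** In the coordinates of c, i(a) reads [(1, acoord c a)] and the image of v under the linear part
    of i reads [(0, alin c v)]; the formula solves [z = z(1) i(a) + i(v)] for v. *)
Definition bidual_part (c : atriv E) m (a : E m) (z : bidual E m) : V m :=
  alinv c m (rsubmx (vcoord (c : vtriv (bidual E)) z) - z (aff1 m) *: acoord c a).

Lemma bidual_partE (c : atriv E) m (a : E m) (z : bidual E m) : adom c m ->
  z = z (aff1 m) *: ii a + bi (bidual_part c a z).
Proof.
move=> cm; rewrite -[LHS](vcoordK (v := bidual E) (c := c) cm).
rewrite -[RHS](vcoordK (v := bidual E) (c := c) cm); congr (vframe _ _ _).
apply/rowP => k; case: (split_ordP k) => {}j ->.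
  by rewrite (ord1 j) !vcoord_lshift /= mulr1 addr0.
rewrite [RHS]vcoord_rshift.
transitivity (z (aff1 m) * acoord c a 0 j + alin c (bidual_part c a z) 0 j).
  by rewrite (alinvK cm) !mxE; ring.
by rewrite -adframe_lin -adframe_fun.
Qed.

Lemma bidual_part_unique (c : atriv E) m (a : E m) f v : adom c m ->
  bidual_part c a (f *: ii a + bi v) = v.
Proof.
move=> cm; have := bidual_partE a (f *: ii a + bi v) cm.
by rewrite {2}/GRing.scale /= mulr1 addr0 => /addrI/immersion_lin_inj.
Qed.

Fact eval1_smooth (z : section (bidual E)) :
  smooth_on setT (fun m => z m (aff1 m)).
Proof.
apply: smooth_on_local => m _; have [c cm] := @adom_cover _ _ _ E m.
have oc := @adom_open _ _ _ E c.
exists (adom c) => //; apply: (@smooth_on_ext _ _ _ _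
    (fun p => vcoord (c : vtriv (bidual E)) (z p) 0 (lshift _ 0))) => //.
  by move=> p _; rewrite vcoord_lshift.
by apply: smooth_on_coord => //; exact: (@sec_smooth _ _ (bidual E) z c).
Qed.

Definition eval1 (z : section (bidual E)) : Cinf M := MkCinf (eval1_smooth z).

Definition atriv_at (m : M) : atriv E := projT1 (cid (@adom_cover _ _ _ E m)).

Lemma atriv_atP m : adom (atriv_at m) m.
Proof. exact: projT2 (cid (@adom_cover _ _ _ E m)). Qed.

Definition vpart_fun (s : Sec E) m (z : bidual E m) : V m :=
  bidual_part (atriv_at m) (s m) z.

(** The decomposition is unique, so the arbitrary trivialization picked at each point can be traded
    for one fixed c on its whole domain; smoothness is checked there. *)
Lemma vpart_funE (s : Sec E) (c : atriv E) m (z : bidual E m) : adom c m ->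
  vpart_fun s z = bidual_part c (s m) z.
Proof.
move=> cm; rewrite (bidual_partE (s m) z cm) bidual_part_unique //.
by rewrite /vpart_fun bidual_part_unique //; exact: atriv_atP.
Qed.

Fact vpart_smooth (s : Sec E) (z : section (bidual E)) (d : vtriv V) :
  smooth_on (vdom d) (fun m => vcoord d (vpart_fun s (z m))).
Proof.
apply: smooth_on_local => m dm; have [c cm] := @adom_cover _ _ _ E m.
have oI : open (adom c `&` vdom d).
  by apply: openI; [exact: adom_open|exact: vdom_open].
exists (adom c `&` vdom d) => //.
apply: (@smooth_on_ext _ _ _ _ (fun p => vcoord d (bidual_part c (s p) (z p)))) => //.
  by move=> p [cp _]; rewrite -vpart_funE.
apply: (@smooth_on_linear _ _ _ _ _ (fun p y => vcoord d (alinv c p y))) => //.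
- by move=> p [cp _] a x y; rewrite alinv_linear // vcoord_linear.
- by move=> y; exact: alinv_smooth.
apply: smooth_on_rV => // j.
have sz : smooth_on (adom c `&` vdom d) (fun p => vcoord (c : vtriv (bidual E)) (z p)).
  by apply: smooth_onS (@sec_smooth _ _ (bidual E) z c) => p [].
have ss : smooth_on (adom c `&` vdom d) (fun p => acoord c (s p)).
  by apply: smooth_onS (@asec_smooth _ _ _ _ s c) => p [].
apply: (@smooth_on_ext _ _ _ _ (fun p =>
    vcoord (c : vtriv (bidual E)) (z p) 0 (rshift 1 j) +
    - (eval1 z p *: (acoord c (s p) 0 j : R^o)))) => //.
  by move=> p _; rewrite !mxE.
apply: smooth_onD => //; first exact: (@smooth_on_coord _ _ _ _ _ (rshift 1 j) oI sz).
apply: smooth_onN => //; apply: smooth_on_scale => //.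
  by apply: smooth_onS (@cinf_smooth _ _ (eval1 z)).
exact: smooth_on_coord.
Qed.

Definition vpart (s : Sec E) (z : section (bidual E)) : section V :=
  MkSection (vpart_smooth s z).

Lemma section_decomp (s : Sec E) (z : section (bidual E)) :
  z = eval1 z *:: imm s + immb E (vpart s z).
Proof. apply: section_eq => m; exact: bidual_partE (atriv_atP m). Qed.

Lemma immb_inj : injective (@immb R M V E).
Proof.
move=> u v uv; apply: section_eq => m; apply: immersion_lin_inj.
exact: (congr1 (fun z : section (bidual E) => sec_fun z m) uv).
Qed.

Lemma eval1_decomp f (s : Sec E) v : eval1 (f *:: imm s + immb E v) = f.
Proof. by apply: Cinf_eq => m /=; rewrite mulr1 addr0. Qed.

Lemma vpart_decomp f (s : Sec E) v : vpart s (f *:: imm s + immb E v) = v.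
Proof.
apply: section_eq => m; exact: bidual_part_unique (atriv_atP m).
Qed.

End bidual_decomposition.

(** * From the bidual to the affine bundle *)

Section linear_functions.
Context {R : realType} {U W : lmodType R} (f : U -> W) (lf : linear f).

Lemma linear_funD u v : f (u + v) = f u + f v.
Proof. by have := lf 1 u v; rewrite !scale1r. Qed.

Lemma linear_fun0 : f 0 = 0.
Proof. by have /eqP := linear_funD 0 0; rewrite addr0 addrC -subr_eq subrr => /eqP. Qed.

Lemma linear_funZ a u : f (a *: u) = a *: f u.
Proof. by have := lf a u 0; rewrite linear_fun0 !addr0. Qed.

Lemma linear_funN u : f (- u) = - f u.
Proof. by rewrite -scaleN1r linear_funZ scaleN1r. Qed.
End linear_functions.

Section lie_bracket_theory.
Context {R : realType} (W : lmodType R) (br : W -> W -> W).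
Hypothesis brL : lie_bracket br.

Lemma lie_bracket_linear u : linear (br u).
Proof. by case: brL. Qed.

Lemma lie_bracket_linear_l u : linear (br^~ u).
Proof. by case: brL. Qed.

Lemma lie_bracketC u v : br u v = - br v u.
Proof.
have [_ _ alt _] := brL; apply/eqP; rewrite -addr_eq0 addrC.
have := alt (u + v); rewrite (linear_funD (lie_bracket_linear_l _)).
by rewrite !(linear_funD (lie_bracket_linear _)) !alt add0r addr0 addrC => ->.
Qed.

Lemma lie_bracket_jacobi u v w : br u (br v w) = br (br u v) w + br v (br u w).
Proof.
have [_ _ _ /(_ u v w)/eqP] := brL; rewrite -addrA addr_eq0 => /eqP ->.
rewrite [br w u]lie_bracketC (linear_funN (lie_bracket_linear _)) (lie_bracketC w).
by rewrite opprD !opprK addrC.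
Qed.
End lie_bracket_theory.

Section immersion_sections.
Context {R : realType} {M : manifold R} {V : vbundle M} {E : abundle V}.
Implicit Types (s : Sec E) (v w : section V) (f : Cinf M).

Lemma imm_tr s v : imm (atr s v : Sec E) = imm s + immb E v.
Proof. by apply: section_eq => m; exact: immersion_tr. Qed.

Lemma immb_tr s v : immb E v = imm (atr s v : Sec E) - imm s.
Proof. by rewrite imm_tr addrC addKr. Qed.

Lemma immb_linear a v w : immb E (a *: v + w) = a *: immb E v + immb E w.
Proof. by apply: section_eq => m; exact: immersion_lin_linear. Qed.

Lemma immb_scale f v : immb E (f *:: v) = f *:: immb E v.
Proof.
by apply: section_eq => m; exact: linear_funZ (@immersion_lin_linear _ _ _ E m) _ _.
Qed.

End immersion_sections.

(** The linear part is a separate field, but any point of the nonempty fibre recovers it as a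
    difference of values. *)
Lemma abmap_eq (R : realType) (M : manifold R) (V : vbundle M) (E : abundle V)
    (W : vbundle M) (F G : abmap E W) :
  (forall m (a : E m), F m a = G m a) -> F = G.
Proof.
move=> FG.
have FGl m (v : V m) : amap_lin F v = amap_lin G v.
  have [c cm] := @adom_cover _ _ _ E m; pose a := aframe c m 0.
  by have := FG m (atr a v); rewrite !amap_tr FG => /addrI.
case: F G FG FGl => f fl lf tf sf [g gl lg tg sg] /= FG FGl.
have {}FG : f = g.
  by apply: functional_extensionality_dep => m; apply: functional_extensionality_dep.
have {}FGl : fl = gl.
  by apply: functional_extensionality_dep => m; apply: functional_extensionality_dep.
by subst g gl; congr ABMap; exact: Prop_irrelevance.
Qed.

(** * The structure induced on E *)

Section restriction.
Context {R : realType} {M : manifold R} {V : vbundle M} {E : abundle V}.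
Variable A : vLieAlgebroid (bidual E).
Hypothesis Aclosed : imm_bracket_closed A.

Let brl := @lie_bracket_linear _ _ _ (vbr_lie A).
Let brr := @lie_bracket_linear_l _ _ _ (vbr_lie A).

Lemma bracket_imm_immb (s : Sec E) (v : section V) :
  exists w, vbr A (imm s) (immb E v) = immb E w.
Proof.
rewrite (immb_tr s) linear_funD // linear_funN //.
by have [_ _ -> _] := vbr_lie A; rewrite oppr0 addr0; exact: Aclosed.
Qed.

Lemma bracket_immb_immb (v w : section V) :
  exists u, vbr A (immb E v) (immb E w) = immb E u.
Proof.
have [s] := exists_global_section E.
have [u1 E1] := bracket_imm_immb (atr s v : Sec E) w.
have [u2 E2] := bracket_imm_immb s w.
exists (u1 - u2); rewrite {1}(immb_tr s) (linear_funD (brr _)) (linear_funN (brr _)).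
by rewrite E1 E2 (linear_funD immb_linear) (linear_funN immb_linear).
Qed.

Let rbr v w := projT1 (cid (bracket_immb_immb v w)).
Let rD s v := projT1 (cid (bracket_imm_immb s v)).

Let rbrE v w : immb E (rbr v w) = vbr A (immb E v) (immb E w).
Proof. exact: esym (projT2 (cid (bracket_immb_immb v w))). Qed.

Let rDE s v : immb E (rD s v) = vbr A (imm s) (immb E v).
Proof. exact: esym (projT2 (cid (bracket_imm_immb s v))). Qed.

Fact restr_anchor_linear m :
  linear (fun v : V m => vanchor A m (immersion_lin E v)).
Proof. by move=> a u v; rewrite immersion_lin_linear vmap_linear. Qed.

Fact restr_anchor_tr m (a : E m) v :
  vanchor A m (immersion_fun (atr a v)) =
  vanchor A m (immersion_fun a) + vanchor A m (immersion_lin E v).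
Proof. by rewrite immersion_tr (linear_funD (@vmap_linear _ _ _ _ (vanchor A) m)). Qed.

Fact restr_anchor_smooth (c : atriv E) (d : vtriv (TM M)) y :
  smooth_on (adom c `&` vdom d)
    (fun m => vcoord d (vanchor A m (immersion_fun (aframe c m y)))).
Proof.
have ocd : open (adom c `&` vdom d).
  by apply: openI; [exact: adom_open|exact: vdom_open].
pose c' : vtriv (bidual E) := c.
apply: (@smooth_on_ext _ _ _ _ (fun m => vcoord d (vanchor A m
    (vframe c' m (vcoord c' (immersion_fun (aframe c m y))))))) => //.
  by move=> m [cm _]; rewrite (vcoordK (v := bidual E) (c := c') cm).
apply: (@smooth_on_linear _ _ _ _ _
    (fun m x => vcoord d (vanchor A m (vframe c' m x)))) => //.
- by move=> m [cm _] a x z; rewrite vframe_linear // vmap_linear vcoord_linear.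
- by move=> x; exact: (@vmap_smooth _ _ _ _ (vanchor A) c' d x).
- apply: smooth_onS (@immersion_smooth _ _ _ E c c' y) => m [cm _] //.
Qed.

Definition restr_anchor : abmap E (TM M) :=
  ABMap restr_anchor_linear restr_anchor_tr restr_anchor_smooth.

Fact restr_lie : aff_lie_structure rbr rD.
Proof.
have [_ _ alt jac] := vbr_lie A.
split; first split.
- move=> u a v w; apply: (@immb_inj _ _ _ E).
  by rewrite immb_linear !rbrE immb_linear brl.
- move=> u a v w; apply: (@immb_inj _ _ _ E).
  by rewrite immb_linear !rbrE immb_linear brr.
- move=> u; apply: (@immb_inj _ _ _ E).
  by rewrite rbrE alt (linear_fun0 immb_linear).
- move=> u v w; apply: (@immb_inj _ _ _ E).
  by rewrite !(linear_funD immb_linear) !rbrE jac (linear_fun0 immb_linear).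
- move=> s a v w; apply: (@immb_inj _ _ _ E).
  by rewrite immb_linear !rDE immb_linear brl.
- move=> s v w; apply: (@immb_inj _ _ _ E).
  rewrite (linear_funD immb_linear) !(rDE, rbrE).
  exact: lie_bracket_jacobi (vbr_lie A) _ _ _.
- move=> s v w; apply: (@immb_inj _ _ _ E).
  by rewrite (linear_funD immb_linear) !(rDE, rbrE) imm_tr (linear_funD (brr _)).
Qed.

Fact restr_leibniz (s : Sec E) (v : section V) (f : Cinf M) :
  rD s (f *:: v) = lie_der (amap_sec restr_anchor s) f *:: v + f *:: rD s v.
Proof.
apply: (@immb_inj _ _ _ E).
have -> : amap_sec restr_anchor s = vmap_sec (vanchor A) (imm s).
  exact: section_eq.
by rewrite (linear_funD immb_linear) !immb_scale !rDE immb_scale vbr_leibniz.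
Qed.

Definition restriction : aLieAlgebroid E := ALieAlgebroid restr_lie restr_leibniz.

Lemma restriction_induced : induces A restriction.
Proof. by split=> // s; apply: section_eq. Qed.
End restriction.

Lemma induced_unique (R : realType) (M : manifold R) (V : vbundle M)
    (E : abundle V) (A : vLieAlgebroid (bidual E)) (B C : aLieAlgebroid E) :
  induces A B -> induces A C -> B = C.
Proof.
move=> [Bbr BD Ba] [Cbr CD Ca].
have ebr : abr B = abr C.
  apply/funext => v; apply/funext => w; apply: (@immb_inj _ _ _ E).
  by rewrite Bbr Cbr.
have eD : aD B = aD C.
  apply/funext => s; apply/funext => v; apply: (@immb_inj _ _ _ E).
  by rewrite BD CD.
have ea : aanchor B = aanchor C.
  apply: abmap_eq => m a; have [s <-] := asection_through a.
  by have /(congr1 (fun X : section (TM M) => sec_fun X m)) := etrans (Ba s) (esym (Ca s)).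
case: B C ebr eD ea {Bbr BD Ba Cbr CD Ca} => br1 D1 a1 l1 i1 [br2 D2 a2 l2 i2] /=.
by move=> ? ? ?; subst br2 D2 a2; congr ALieAlgebroid; exact: Prop_irrelevance.
Qed.

(** * Formulas valid for every extension *)

Section bracket_formula.
Context {R : realType} {M : manifold R} {V : vbundle M} {E : abundle V}.
Variables (A : vLieAlgebroid (bidual E)) (B : aLieAlgebroid E).
Hypothesis AB : induces A B.

Lemma anchor_immb (v : section V) :
  vmap_sec (vanchor A) (immb E v) = vmap_sec (amap_linear (aanchor B)) v.
Proof.
have [s] := exists_global_section E; have [_ _ anc] := AB.
apply: section_eq => m; have lA := @vmap_linear _ _ _ _ (vanchor A) m.
have e t := congr1 (fun X : section (TM M) => sec_fun X m) (anc t).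
have := e (atr s v : Sec E); rewrite imm_tr /= amap_tr (linear_funD lA).
by rewrite [aanchor B m (s m)](e s) => /addrI.
Qed.

Lemma anchor_formula (s : Sec E) (f : Cinf M) (v : section V) :
  vmap_sec (vanchor A) (f *:: imm s + immb E v) =
  f *:: amap_sec (aanchor B) s + vmap_sec (amap_linear (aanchor B)) v.
Proof.
have [_ _ anc] := AB; rewrite -anchor_immb anc.
by apply: section_eq => m; exact: vmap_linear.
Qed.

Lemma vbr_leibniz_l (W : vbundle M) (L : vLieAlgebroid W) (z w : section W)
    (f : Cinf M) :
  vbr L (f *:: z) w = f *:: vbr L z w - lie_der (vmap_sec (vanchor L) w) f *:: z.
Proof.
rewrite (lie_bracketC (vbr_lie L)) vbr_leibniz (lie_bracketC (vbr_lie L) z) opprD.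
rewrite addrC; congr (_ + _); apply: section_eq => m /=; by rewrite scalerN.
Qed.

Lemma bracket_formula (s : Sec E) (f1 f2 : Cinf M) (v1 v2 : section V) :
  let z1 := f1 *:: imm s + immb E v1 in
  let z2 := f2 *:: imm s + immb E v2 in
  vbr A z1 z2 =
  (lie_der (vmap_sec (vanchor A) z1) f2
     - lie_der (vmap_sec (vanchor A) z2) f1) *:: imm s
  + immb E (abr B v1 v2 + f1 *:: aD B s v2 - f2 *:: aD B s v1).
Proof.
move=> z1 z2; have [br D _] := AB; have [_ _ alt _] := vbr_lie A.
have brl := @lie_bracket_linear _ _ _ (vbr_lie A).
rewrite {1}/z2 (linear_funD (brl _)) vbr_leibniz.
rewrite {2 3}/z1 !(linear_funD (lie_bracket_linear_l (vbr_lie A) _)) !vbr_leibniz_l alt.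
(* Expanding z2 first keeps the derivative of f2 along z1 whole, while the derivative of f1 appears
   split along the two summands of z2. *)
have e : lie_der (vmap_sec (vanchor A) z2) f1 =
    CinfM f2 (lie_der (vmap_sec (vanchor A) (imm s)) f1) +
    lie_der (vmap_sec (vanchor A) (immb E v2)) f1.
  apply: Cinf_eq => m; apply: lie_der_linear; exact: vmap_linear.
rewrite e (lie_bracketC (vbr_lie A) (immb E v1) (imm s)) -br -!D.
rewrite (linear_funD immb_linear) (linear_funN immb_linear).
rewrite (linear_funD immb_linear) !immb_scale.
by apply: section_eq => m; apply: dual_eq => phi /=; rewrite [in RHS]/GRing.scale /=; ring.
Qed.
End bracket_formula.

(** * From the affine bundle to the bidual *)

Section scalar_functions.
Context {R : realType} {W : lmodType R} (phi : W -> R) (sphi : scalar phi).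

Lemma scalar_funD u v : phi (u + v) = phi u + phi v.
Proof. exact: (linear_funD (sphi : linear (phi : W -> R^o))). Qed.

Lemma scalar_funN u : phi (- u) = - phi u.
Proof. exact: (linear_funN (sphi : linear (phi : W -> R^o))). Qed.

Lemma scalar_funZ a u : phi (a *: u) = a * phi u.
Proof. exact: (linear_funZ (sphi : linear (phi : W -> R^o))). Qed.
End scalar_functions.

(** Linear forms turn an identity in a fibre into one between reals, where [ring] applies. *)
Lemma fibre_ext (R : realType) (M : manifold R) (V : vbundle M) (m : M)
    (u v : V m) :
  (forall phi : V m -> R, scalar phi -> phi u = phi v) -> u = v.
Proof.
move=> uv; have [c cm] := @vdom_cover _ _ V m.
rewrite -(vcoordK cm u) -(vcoordK cm v); congr (vframe c m _); apply/rowP => j.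
apply: (uv (fun x => vcoord c x 0 j)) => a x y.
by rewrite vcoord_linear !mxE.
Qed.

Lemma scaler_inj_l (R : realType) (W : lmodType R) (x : W) :
  x != 0 -> injective (fun a : R => a *: x).
Proof.
move=> x0 a b /eqP; rewrite -subr_eq0 -scalerBl scaler_eq0 (negbTE x0) orbF.
by rewrite subr_eq0 => /eqP.
Qed.

(* [ring] compares atoms up to conversion, which is very slow on derivatives. *)
Ltac generalize_cinf := repeat match goal with
  |- context [@cinf_fun ?R ?M ?f ?m] => generalize (@cinf_fun R M f m); intro
end.
Ltac cinf_ring := generalize_cinf; ring.
Ltac section_ring phi sphi :=
  rewrite ?(sectionDE, sectionNE, sectionZE, section_scaleE);
  rewrite ?(CinfDE, CinfNE, CinfME, Cinf_cstE);
  rewrite ?(scalar_funD sphi, scalar_funN sphi, scalar_funZ sphi);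
  generalize_cinf;
  repeat match goal with |- context [phi ?x] => generalize (phi x); intro end;
  ring.

#[local] Opaque lie_der.

(** The symbol of a commutator of derivations is the commutator of the symbols. On [f *:: v] the
    first-order cross terms cancel, and what remains is a function times v, from which the nonzero
    value of v at m is cancelled. *)
Lemma commutator_anchor (R : realType) (M : manifold R) (V : vbundle M)
    (D1 D2 D3 : section V -> section V) (X1 X2 X3 : section (TM M)) (m : M) :
  linear D1 -> linear D2 ->
  (forall f v, D1 (f *:: v) = lie_der X1 f *:: v + f *:: D1 v) ->
  (forall f v, D2 (f *:: v) = lie_der X2 f *:: v + f *:: D2 v) ->
  (forall f v, D3 (f *:: v) = lie_der X3 f *:: v + f *:: D3 v) ->
  (forall v, D3 v = D1 (D2 v) - D2 (D1 v)) ->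
  (exists v : V m, v <> 0) -> forall f : Cinf M,
  lie_der X3 f m = lie_der X1 (lie_der X2 f) m - lie_der X2 (lie_der X1 f) m.
Proof.
move=> l1 l2 L1 L2 L3 comm [x x0] f; have [v vm] := section_through x.
have := congr1 (fun s : section V => sec_fun s m) (comm (f *:: v)).
rewrite L3 comm L1 L2 (linear_funD l1) (linear_funD l2) !L1 !L2 /= vm => e.
have x0' : x != 0 by apply/eqP.
apply: (scaler_inj_l x0'); apply: fibre_ext => phi lphi.
have /eqP := congr1 phi e; rewrite -subr_eq0 => /eqP.
move=> e0; apply/eqP; rewrite -subr_eq0 -[X in _ == X]e0; apply/eqP; clear e0 e.
section_ring phi lphi.
Qed.

(** The rank is constant over the domain of a trivialization. *)
Lemma fibre_null_near (R : realType) (M : manifold R) (V : vbundle M) (m : M) :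
  (forall v : V m, v = 0) -> \forall p \near m, forall v : V p, v = 0.
Proof.
move=> Vm; have [c cm] := @vdom_cover _ _ V m.
apply: filterS (open_nbhs_nbhs (conj (@vdom_open _ _ V c) cm)) => p cp v.
rewrite -(vcoordK cp v) -(vframeK cm (vcoord c v)) (Vm (vframe _ _ _)).
by rewrite (linear_fun0 (@vcoord_linear _ _ V c m)) (linear_fun0 (vframe_linear cp)).
Qed.

Section vpart_linearity.
Context {R : realType} {M : manifold R} {V : vbundle M} {E : abundle V}.
Variable s : Sec E.

Lemma vpart_fun_linear m : linear (@vpart_fun R M V E s m).
Proof.
move=> a z w; have cm := @atriv_atP _ _ _ E m.
rewrite /vpart_fun /bidual_part -(alinv_linear cm) vcoord_linear; congr (alinv _ m _).
by apply/rowP => j; rewrite !mxE /=; ring.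
Qed.

End vpart_linearity.

(** * The extension built from a fixed section s of E *)

Section extension.
Context {R : realType} {M : manifold R} {V : vbundle M} {E : abundle V}.
Variables (B : aLieAlgebroid E) (s : Sec E).
Implicit Types (v w : section V) (z : section (bidual E)).

Let brL : lie_bracket (abr B). Proof. by case: (aD_lie B). Qed.
Let Dlin t : linear (aD B t). Proof. by case: (aD_lie B). Qed.
Let brl := @lie_bracket_linear _ _ _ brL.

Local Notation Xs := (amap_sec (aanchor B) s).
Local Notation Xv := (vmap_sec (amap_linear (aanchor B))).

(** Bracketing with v is the difference of the actions of s + v and s, so its symbol is the
    difference of their anchors, the linear part applied to v. *)
Lemma abr_leibniz v w (f : Cinf M) :
  abr B v (f *:: w) = lie_der (Xv v) f *:: w + f *:: abr B v w.
Proof.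
have [_ _ _ tr] := aD_lie B.
have e u : abr B v u = aD B (atr s v : Sec E) u - aD B s u.
  by rewrite tr addrC addKr.
rewrite !e !aD_leibniz; apply: section_eq => m; apply: fibre_ext => phi sphi.
have := @lie_der_linear _ _ (Xv v) Xs f 1 m (amap_sec (aanchor B) (atr s v : Sec E)).
rewrite /= amap_tr scale1r addrC mul1r => /(_ erefl) ->.
section_ring phi sphi.
Qed.

Lemma anchor_null v (f : Cinf M) m : v m = 0 -> lie_der (Xv v) f m = 0.
Proof.
move=> vm; rewrite !lie_der_diffE /= vm.
by rewrite (linear_fun0 (@amap_lin_linear _ _ _ _ _ (aanchor B) m)) linear0.
Qed.

(** The iterated derivative needs the inner one to vanish near m, not only at m. *)
Lemma fibre_null_anchor m : ~ (exists x : V m, x <> 0) ->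
  forall (X : section (TM M)) v (f : Cinf M),
    lie_der X (lie_der (Xv v) f) m = 0 /\ lie_der (Xv v) f m = 0.
Proof.
move=> nex X v f.
have V0 : forall x : V m, x = 0.
  by move=> x; apply: contrapT => x0; apply: nex; exists x.
split; last exact: anchor_null.
by apply: lie_der_near0; apply: filterS (fibre_null_near V0) => p Vp; exact: anchor_null.
Qed.

(** That [aD B s] is a derivation of the bracket says that its commutator with bracketing by v is
    bracketing by [aD B s v]. *)
Lemma anchor_aD v (f : Cinf M) m : lie_der (Xv (aD B s v)) f m =
  lie_der Xs (lie_der (Xv v) f) m - lie_der (Xv v) (lie_der Xs f) m.
Proof.
have [_ _ der _] := aD_lie B.
have [ex|/fibre_null_anchor n0] := pselect (exists x : V m, x <> 0).
  apply: (@commutator_anchor _ _ _ (aD B s) (abr B v) (abr B (aD B s v))) => //.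
  - by move=> g w; exact: aD_leibniz.
  - by move=> g w; exact: abr_leibniz.
  - by move=> g w; exact: abr_leibniz.
  - by move=> w; rewrite der addrK.
by rewrite (n0 Xs _ f).2 (n0 Xs v f).1 (n0 Xs v _).2 subrr.
Qed.

Lemma anchor_abr v w (f : Cinf M) m : lie_der (Xv (abr B v w)) f m =
  lie_der (Xv v) (lie_der (Xv w) f) m - lie_der (Xv w) (lie_der (Xv v) f) m.
Proof.
have [ex|/fibre_null_anchor n0] := pselect (exists x : V m, x <> 0).
  apply: (@commutator_anchor _ _ _ (abr B v) (abr B w) (abr B (abr B v w))) => //.
  - by move=> g u; exact: abr_leibniz.
  - by move=> g u; exact: abr_leibniz.
  - by move=> g u; exact: abr_leibniz.
  - by move=> u; rewrite (lie_bracket_jacobi brL v) addrK.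
by rewrite (n0 Xs _ f).2 (n0 (Xv v) w f).1 (n0 (Xv w) v f).1 subrr.
Qed.

Local Notation e := (@eval1 R M V E).
Local Notation p := (vpart s).

Definition ext_anchor_fun m (z : bidual E m) : TM M m :=
  z (aff1 m) *: aanchor B m (s m) + amap_lin (aanchor B) (vpart_fun s z).

Fact ext_anchor_linear m : linear (@ext_anchor_fun m).
Proof.
move=> a z w; rewrite /ext_anchor_fun vpart_fun_linear amap_lin_linear.
by rewrite scalerDr scalerDl scalerA addrACA.
Qed.

Fact ext_anchor_smooth (c : vtriv (bidual E)) (d : vtriv (TM M)) y :
  smooth_on (vdom c `&` vdom d) (fun m => vcoord d (ext_anchor_fun (vframe c m y))).
Proof.
have ocd : open (vdom c `&` vdom d) by apply: openI; exact: vdom_open.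
pose c' : atriv E := c.
(* The value on the constant function 1 of the vector with coordinates y: it does not vary with
   m. *)
pose y0 : R := y 0 (lshift _ 0).
apply: (@smooth_on_ext _ _ _ _ (fun m => y0 *: vcoord d (aanchor B m (s m)) +
   vcoord d (amap_lin (aanchor B) (alinv c' m (rsubmx y - y0 *: acoord c' (s m)))))) => //.
  move=> m [cm dm].
  have yE : vcoord c (vframe c m y) = y by exact: vframeK.
  have y0E : vframe c m y (aff1 m) = y0.
    by rewrite -(vcoord_lshift c') /y0 -[in RHS]yE.
  rewrite /ext_anchor_fun vcoord_linear (vpart_funE s _ (cm : adom c' m)).
  by rewrite /bidual_part yE y0E.
apply: smooth_onD => //.
  apply: smooth_onZ => //.
  by apply: smooth_onS (@amap_sec_smooth _ _ _ _ _ (aanchor B) s d) => m [].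
apply: (@smooth_on_linear _ _ _ _ _
    (fun m x => vcoord d (amap_lin (aanchor B) (alinv c' m x)))) => //.
- by move=> m [cm _] a x z; rewrite alinv_linear // amap_lin_linear vcoord_linear.
- by move=> x; exact: amap_lin_frame_smooth.
apply: smooth_onD => //; first exact: smooth_on_cst.
apply: smooth_onN => //; apply: smooth_onZ => //.
by apply: smooth_onS (@asec_smooth _ _ _ _ s c') => m [].
Qed.

Definition ext_anchor : vbmap (bidual E) (TM M) :=
  VBMap ext_anchor_linear ext_anchor_smooth.

Local Notation X z := (vmap_sec ext_anchor z).

Lemma ext_anchorE z m :
  X z m = e z m *: aanchor B m (s m) + amap_lin (aanchor B) (p z m).
Proof. by []. Qed.

Lemma lie_der_ext_anchor z f m :
  lie_der (X z) f m = e z m * lie_der Xs f m + lie_der (Xv (p z)) f m.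
Proof. exact: lie_der_linear. Qed.

(* Sealed, so that rewriting does not unfold it. *)
Fact ext_br_def : {br : section (bidual E) -> section (bidual E) -> section (bidual E) |
  forall z w : section (bidual E), e (br z w) = lie_der (X z) (e w) - lie_der (X w) (e z) /\
    p (br z w) = abr B (p z) (p w) + e z *:: aD B s (p w) - e w *:: aD B s (p z)}.
Proof.
exists (fun z w : section (bidual E) => (lie_der (X z) (e w) - lie_der (X w) (e z)) *:: imm s +
  immb E (abr B (p z) (p w) + e z *:: aD B s (p w) - e w *:: aD B s (p z))).
by move=> z w; rewrite eval1_decomp vpart_decomp.
Qed.

Definition ext_br := projT1 ext_br_def.

Lemma eval1_ext_br (z w : section (bidual E)) :
  e (ext_br z w) = lie_der (X z) (e w) - lie_der (X w) (e z).
Proof. exact: (projT2 ext_br_def z w).1. Qed.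

Lemma vpart_ext_br (z w : section (bidual E)) : p (ext_br z w) =
  abr B (p z) (p w) + e z *:: aD B s (p w) - e w *:: aD B s (p z).
Proof. exact: (projT2 ext_br_def z w).2. Qed.

Let lin_lin := @amap_lin_linear _ _ _ _ _ (aanchor B).

Lemma lie_der_amapD v w f m :
  lie_der (Xv (v + w)) f m = lie_der (Xv v) f m + lie_der (Xv w) f m.
Proof. by rewrite !lie_der_diffE /= (linear_funD (@lin_lin m)) linearD. Qed.

Lemma lie_der_amapN v f m : lie_der (Xv (- v)) f m = - lie_der (Xv v) f m.
Proof. by rewrite !lie_der_diffE /= (linear_funN (@lin_lin m)) linearN. Qed.

Lemma lie_der_amapZ (g : Cinf M) v f m :
  lie_der (Xv (g *:: v)) f m = g m * lie_der (Xv v) f m.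
Proof. by rewrite !lie_der_diffE /= (linear_funZ (@lin_lin m)) linearZ. Qed.

(** This is what the Jacobi identity requires along i(s). *)
Lemma anchor_ext_br (z w : section (bidual E)) f m : lie_der (X (ext_br z w)) f m =
  lie_der (X z) (lie_der (X w) f) m - lie_der (X w) (lie_der (X z) f) m.
Proof.
have expand u g : lie_der (X u) g =
    CinfM (e u) (lie_der Xs g) + lie_der (Xv (p u)) g.
  by apply: Cinf_eq => q; exact: lie_der_ext_anchor.
rewrite lie_der_ext_anchor eval1_ext_br vpart_ext_br.
rewrite !(lie_der_amapD, lie_der_amapN, lie_der_amapZ) anchor_abr !anchor_aD.
rewrite !expand !(CinfDE, CinfNE, CinfME, lie_derD, lie_derM); cinf_ring.
Qed.

Lemma bidual_section_eq (z w : section (bidual E)) : e z = e w -> p z = p w -> z = w.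
Proof.
by move=> ee pp; rewrite (section_decomp s z) (section_decomp s w) ee pp.
Qed.

Lemma eval1_linear a (z w : section (bidual E)) :
  e (a *: z + w) = CinfM (Cinf_cst M a) (e z) + e w.
Proof. exact: Cinf_eq. Qed.

Lemma eval1_scale f z : e (f *:: z) = CinfM f (e z).
Proof. exact: Cinf_eq. Qed.

Lemma vpart_linear : linear p.
Proof. by move=> a z w; apply: section_eq => m; exact: vpart_fun_linear. Qed.

Lemma vpart_scale f z : p (f *:: z) = f *:: p z.
Proof. by apply: section_eq => m; exact: (linear_funZ (@vpart_fun_linear _ _ _ _ s m)). Qed.

Lemma eval1N z : e (- z) = - e z.
Proof. exact: Cinf_eq. Qed.

Lemma eval1D (z w : section (bidual E)) : e (z + w) = e z + e w.
Proof. exact: Cinf_eq. Qed.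

Lemma eval10 : e 0 = Cinf_cst M 0.
Proof. exact: Cinf_eq. Qed.

Lemma lie_der_ext_linear a (z w : section (bidual E)) f m :
  lie_der (X (a *: z + w)) f m = a * lie_der (X z) f m + lie_der (X w) f m.
Proof. by apply: lie_der_linear; exact: (@vmap_linear _ _ _ _ ext_anchor m). Qed.

#[local] Opaque ext_br eval1 vpart ext_anchor CinfM.

Lemma ext_brC (z w : section (bidual E)) : ext_br z w = - ext_br w z.
Proof.
apply: bidual_section_eq.
  by rewrite eval1N !eval1_ext_br opprB.
rewrite (linear_funN vpart_linear) !vpart_ext_br (lie_bracketC brL).
apply: section_eq => m; apply: fibre_ext => phi sphi.
section_ring phi sphi.
Qed.

Lemma ext_br_linear z : linear (ext_br z).
Proof.
move=> a u w; apply: bidual_section_eq.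
  rewrite eval1_linear !eval1_ext_br eval1_linear; apply: Cinf_eq => m.
  rewrite !(CinfDE, CinfNE, CinfME, Cinf_cstE, lie_derD, lie_der_scale, lie_der_ext_linear).
  cinf_ring.
rewrite vpart_linear !vpart_ext_br vpart_linear eval1_linear brl Dlin.
apply: section_eq => m; apply: fibre_ext => phi sphi.
section_ring phi sphi.
Qed.

Lemma ext_br_linear_l z : linear (ext_br^~ z).
Proof.
move=> a u w; rewrite ext_brC ext_br_linear opprD -scalerN.
by rewrite -!(ext_brC _ z).
Qed.

Lemma ext_br_alt z : ext_br z z = 0.
Proof.
have [_ _ alt _] := brL.
apply: bidual_section_eq; first by rewrite eval1_ext_br subrr eval10.
by rewrite vpart_ext_br alt add0r subrr (linear_fun0 vpart_linear).
Qed.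

Lemma ext_br_jacobi (z1 z2 z3 : section (bidual E)) :
  ext_br z1 (ext_br z2 z3) + ext_br z2 (ext_br z3 z1) + ext_br z3 (ext_br z1 z2) = 0.
Proof.
have pD := linear_funD vpart_linear.
apply: bidual_section_eq.
  rewrite eval10 !eval1D !eval1_ext_br; apply: Cinf_eq => m.
  rewrite !(CinfDE, CinfNE, lie_derD, lie_derN, anchor_ext_br, Cinf_cstE); cinf_ring.
have [_ _ der _] := aD_lie B.
have term (u v w : section (bidual E)) : p (ext_br u (ext_br v w)) =
    abr B (p u) (abr B (p v) (p w)) +
    (lie_der (Xv (p u)) (e v) *:: aD B s (p w) + e v *:: abr B (p u) (aD B s (p w))) -
    (lie_der (Xv (p u)) (e w) *:: aD B s (p v) + e w *:: abr B (p u) (aD B s (p v))) +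
    e u *:: (abr B (aD B s (p v)) (p w) + abr B (p v) (aD B s (p w)) +
      (lie_der Xs (e v) *:: aD B s (p w) + e v *:: aD B s (aD B s (p w))) -
      (lie_der Xs (e w) *:: aD B s (p v) + e w *:: aD B s (aD B s (p v)))) -
    (lie_der (X v) (e w) - lie_der (X w) (e v)) *:: aD B s (p u).
  rewrite vpart_ext_br eval1_ext_br vpart_ext_br.
  rewrite (linear_funD (brl _)) (linear_funN (brl _)) (linear_funD (brl _)) !abr_leibniz.
  by rewrite (linear_funD (Dlin _)) (linear_funN (Dlin _)) (linear_funD (Dlin _)) !aD_leibniz der.
rewrite 2!pD !term (linear_fun0 vpart_linear).
(* Moving the derivative to the right slot makes the mixed brackets of the cyclic sum cancel
   syntactically. *)
rewrite (lie_bracketC brL (aD B s (p z1))) (lie_bracketC brL (aD B s (p z2))).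
rewrite (lie_bracketC brL (aD B s (p z3))).
have [_ _ _ /(_ (p z1) (p z2) (p z3)) jac] := brL.
apply: section_eq => m; apply: fibre_ext => phi sphi.
have := congr1 (fun v : section V => phi (sec_fun v m)) jac.
rewrite /= !lie_der_ext_anchor.
(* The only terms that do not cancel form the Jacobi sum of [abr], which takes the place of 0 on the
   right. *)
rewrite !(scalar_funD sphi) => <-; section_ring phi sphi.
Qed.

Lemma ext_br_leibniz (z w : section (bidual E)) (f : Cinf M) :
  ext_br z (f *:: w) = lie_der (X z) f *:: w + f *:: ext_br z w.
Proof.
have pS := vpart_scale; have pD := linear_funD vpart_linear.
have XS (u : section (bidual E)) g m :
    lie_der (X (f *:: u)) g m = f m * lie_der (X u) g m.
  by rewrite !lie_der_diffE /= (linear_funZ (@vmap_linear _ _ _ _ ext_anchor m)) linearZ.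
apply: bidual_section_eq.
  rewrite eval1D !eval1_scale !eval1_ext_br eval1_scale; apply: Cinf_eq => m.
  rewrite !(CinfDE, CinfNE, CinfME, lie_derM, XS); cinf_ring.
rewrite pD !pS !vpart_ext_br pS eval1_scale abr_leibniz aD_leibniz.
apply: section_eq => m; apply: fibre_ext => phi sphi.
rewrite !sectionDE !section_scaleE lie_der_ext_anchor; section_ring phi sphi.
Qed.

Fact ext_br_lie : lie_bracket ext_br.
Proof.
by split; [exact: ext_br_linear|exact: ext_br_linear_l|exact: ext_br_alt|
  exact: ext_br_jacobi].
Qed.

Definition extension : vLieAlgebroid (bidual E) :=
  VLieAlgebroid ext_br_lie ext_br_leibniz.

Lemma immb_decomp v : immb E v = Cinf_cst M 0 *:: imm s + immb E v.
Proof. by apply: section_eq => m; rewrite sectionDE section_scaleE Cinf_cstE scale0r add0r. Qed.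

Lemma imm_decomp (t : Sec E) : imm t = Cinf_cst M 1 *:: imm s + immb E (asub t s).
Proof.
apply: section_eq => m; rewrite sectionDE section_scaleE Cinf_cstE scale1r.
by rewrite -sectionDE -imm_tr asubK.
Qed.

Lemma eval1_immb v : e (immb E v) = Cinf_cst M 0.
Proof. by rewrite immb_decomp eval1_decomp. Qed.

Lemma eval1_imm (t : Sec E) : e (imm t) = Cinf_cst M 1.
Proof. by rewrite imm_decomp eval1_decomp. Qed.

Lemma vpart_immb v : p (immb E v) = v.
Proof. by rewrite immb_decomp vpart_decomp. Qed.

Lemma vpart_imm (t : Sec E) : p (imm t) = asub t s.
Proof. by rewrite imm_decomp vpart_decomp. Qed.

(** Sections i(t) have the constant coefficient 1 along i(s), whose derivatives vanish. *)
Lemma extension_closed : imm_bracket_closed extension.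
Proof.
move=> t u; exists (p (ext_br (imm t) (imm u))).
apply: bidual_section_eq; last by rewrite vpart_immb.
rewrite eval1_immb eval1_ext_br !eval1_imm; apply: Cinf_eq => m.
by rewrite CinfDE CinfNE !lie_der_cst subrr Cinf_cstE.
Qed.

Lemma extension_induces : induces extension B.
Proof.
split=> [v w|t v|t].
- apply: bidual_section_eq.
    rewrite eval1_immb eval1_ext_br !eval1_immb; apply: Cinf_eq => m.
    by rewrite CinfDE CinfNE !lie_der_cst subrr Cinf_cstE.
  rewrite vpart_ext_br !vpart_immb !eval1_immb; apply: section_eq => m.
  by rewrite !(sectionDE, sectionNE, section_scaleE) Cinf_cstE !scale0r subr0 addr0.
- apply: bidual_section_eq.
    rewrite eval1_immb eval1_ext_br eval1_immb eval1_imm; apply: Cinf_eq => m.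
    by rewrite CinfDE CinfNE !lie_der_cst subrr Cinf_cstE.
  rewrite vpart_ext_br !vpart_immb eval1_immb eval1_imm vpart_imm.
  (* For t other than s, the bracket with t - s in the extended formula supplies the difference
     between the actions of t and s. *)
  have [_ _ _ tr] := aD_lie B; rewrite -{1}(asubK t s) tr; apply: section_eq => m.
  rewrite !(sectionDE, sectionNE, section_scaleE) !Cinf_cstE scale0r scale1r subr0.
  by rewrite addrC.
- apply: section_eq => m; rewrite -{1}(asubK t s) ext_anchorE eval1_imm vpart_imm.
  by rewrite Cinf_cstE scale1r; exact: amap_tr.
Qed.
End extension.

Theorem theorem2 (R : realType) (M : manifold R) (V : vbundle M)
    (E : abundle V) :
  (forall A : vLieAlgebroid (bidual E), imm_bracket_closed A ->
     exists! B : aLieAlgebroid E, induces A B)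
  /\
  (forall B : aLieAlgebroid E,
     (exists A : vLieAlgebroid (bidual E),
        imm_bracket_closed A /\ induces A B)
     /\
     (forall A : vLieAlgebroid (bidual E),
        imm_bracket_closed A -> induces A B ->
        forall s : Sec E,
        [/\ forall z : section (bidual E),
              exists (f : Cinf M) (v : section V), z = f *:: imm s + immb E v,
            forall (f : Cinf M) (v : section V),
              vmap_sec (vanchor A) (f *:: imm s + immb E v) =
              f *:: amap_sec (aanchor B) s
                + vmap_sec (amap_linear (aanchor B)) v
          & forall (f1 f2 : Cinf M) (v1 v2 : section V),
              let z1 := f1 *:: imm s + immb E v1 in
              let z2 := f2 *:: imm s + immb E v2 in
              vbr A z1 z2 =
              (lie_der (vmap_sec (vanchor A) z1) f2
                 - lie_der (vmap_sec (vanchor A) z2) f1) *:: imm s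
              + immb E (abr B v1 v2 + f1 *:: aD B s v2 - f2 *:: aD B s v1)])).
Proof.
split=> [A Aclosed|B].
  exists (restriction Aclosed); split; first exact: restriction_induced.
  by move=> B; apply: induced_unique; exact: restriction_induced.
split.
  have [s] := exists_global_section E.
  by exists (extension B s); split; [exact: extension_closed|exact: extension_induces].
move=> A _ AB s; split=> [z|f v|f1 f2 v1 v2].
- by exists (eval1 z), (vpart s z); exact: section_decomp.
- exact: anchor_formula.
- exact: bracket_formula.
Qed.
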